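(* For every $n\ge1$, the group $nV$ has property FA: every simplicial action of $nV$ on a simplicial tree without edge inversions has a global fixed point. In particular, the number of ends of $nV$ is $e(nV)=1$.
   Context: $nV$ denotes Brin's $n$-dimensional Thompson group: with $I=[0,1)$, dyadic rectangles in $I^n$ are obtained from $I^n$ by repeatedly halving in one coordinate; a pattern is a finite set of pairwise disjoint dyadic rectangles with union $I^n$; for numbered patterns $P=(P_i)_{i<r}$, $Q=(Q_i)_{i<r}$, $g(P,Q)$ maps each $P_i$ onto $Q_i$ by a map $(x_k)_k\mapsto(a_k+2^{j_k}x_k)_k$; $nV$ is the group of all such maps (equivalently a group of homeomorphisms of $C^n$, $C$ the Cantor set). It is finitely generated. For a finitely generated group $G$ with finite generating set $S$, $e(G)$ is the number of ends of the Cayley graph $\Gamma_{G,S}$, i.e. the supremum over finite subgraphs $K$ of the number of unbounded connected components of $\Gamma_{G,S}-K$; it does not depend on $S$. *)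

(* Defs.v *)
From Stdlib Require Import Reals List ZArith Classical.
Open Scope R_scope.

Definition in_cube (n : nat) (x : nat -> R) : Prop :=
  (forall k, (k < n)%nat -> 0 <= x k < 1) /\ (forall k, (n <= k)%nat -> x k = 0).

Definition Cube (n : nat) : Type := { x : nat -> R | in_cube n x }.
Definition pt {n : nat} (x : Cube n) : nat -> R := proj1_sig x.

Definition upd (v : nat -> R) (k : nat) (r : R) : nat -> R :=
  fun i => if Nat.eqb i k then r else v i.

(* A rectangle is given by its lower and upper corner (lo, hi):
   the set of x with lo k <= x k < hi k for all k < n. *)
Definition rect : Type := ((nat -> R) * (nat -> R))%type.

Inductive drect (n : nat) : (nat -> R) -> (nat -> R) -> Prop :=
| drect_full : drect n (fun _ => 0) (fun _ => 1)
| drect_low : forall lo hi k, (k < n)%nat -> drect n lo hi ->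
    drect n lo (upd hi k ((lo k + hi k) / 2))
| drect_high : forall lo hi k, (k < n)%nat -> drect n lo hi ->
    drect n (upd lo k ((lo k + hi k) / 2)) hi.

Definition in_rect {n : nat} (r : rect) (x : Cube n) : Prop :=
  forall k, (k < n)%nat -> fst r k <= pt x k < snd r k.

Definition rect0 : rect := (fun _ => 0, fun _ => 1).

Definition is_pattern (n : nat) (P : list rect) : Prop :=
  Forall (fun r => drect n (fst r) (snd r)) P /\
  (forall i j, (i < length P)%nat -> (j < length P)%nat -> i <> j ->
     forall x : Cube n, ~ (in_rect (nth i P rect0) x /\ in_rect (nth j P rect0) x)) /\
  (forall x : Cube n, exists i, (i < length P)%nat /\ in_rect (nth i P rect0) x).

Definition InNV (n : nat) (f : Cube n -> Cube n) : Prop :=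
  exists P Q : list rect,
    is_pattern n P /\ is_pattern n Q /\ length P = length Q /\
    forall i, (i < length P)%nat ->
      exists (a : nat -> R) (j : nat -> Z),
        (forall x : Cube n, in_rect (nth i P rect0) x ->
           in_rect (nth i Q rect0) (f x) /\
           forall k, (k < n)%nat -> pt (f x) k = a k + powerRZ 2 (j k) * pt x k) /\
        (forall y : Cube n, in_rect (nth i Q rect0) y ->
           exists x, in_rect (nth i P rect0) x /\ f x = y).

Section Graphs.
Context {V : Type} (adj : V -> V -> Prop).

Fixpoint is_walk (p : list V) : Prop :=
  match p with
  | u :: ((v :: _) as q) => adj u v /\ is_walk q
  | _ => True
  end.

Fixpoint no_backtrack (p : list V) : Prop :=
  match p with
  | u :: ((_ :: w :: _) as q) => u <> w /\ no_backtrack q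
  | _ => True
  end.

Definition is_tree : Prop :=
  (forall u v, adj u v -> adj v u) /\ (forall v, ~ adj v v) /\
  inhabited V /\
  (forall u v, exists p, is_walk (u :: p) /\ last p u = v) /\
  (forall u p, p <> nil -> is_walk (u :: p) -> no_backtrack (u :: p) -> last p u <> u).
End Graphs.

Definition simplicial_action (n : nat) {V : Type} (adj : V -> V -> Prop)
    (act : (Cube n -> Cube n) -> V -> V) : Prop :=
  act (fun x => x) = (fun v => v) /\
  (forall g h, InNV n g -> InNV n h ->
     act (fun x => g (h x)) = (fun v => act g (act h v))) /\
  (forall g, InNV n g ->
     (forall w, exists v, act g v = w) /\
     (forall u v, act g u = act g v -> u = v) /\
     (forall u v, adj u v <-> adj (act g u) (act g v))).

Definition without_inversions (n : nat) {V : Type} (adj : V -> V -> Prop)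
    (act : (Cube n -> Cube n) -> V -> V) : Prop :=
  forall g u v, InNV n g -> adj u v -> ~ (act g u = v /\ act g v = u).

Definition nV_has_FA (n : nat) : Prop :=
  forall (V : Type) (adj : V -> V -> Prop) (act : (Cube n -> Cube n) -> V -> V),
    is_tree adj -> simplicial_action n adj act -> without_inversions n adj act ->
    exists v : V, forall g, InNV n g -> act g v = v.

Definition idf (n : nat) : Cube n -> Cube n := fun x => x.

Inductive generated (n : nat) (S : list (Cube n -> Cube n)) : (Cube n -> Cube n) -> Prop :=
| gen_id : generated n S (idf n)
| gen_mul : forall g s, generated n S g -> In s S -> generated n S (fun x => g (s x))
| gen_mulinv : forall g s h, generated n S g -> In s S -> InNV n h ->
    (fun x => s (h x)) = idf n -> (fun x => h (s x)) = idf n ->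
    generated n S (fun x => g (h x)).

Definition generating_set (n : nat) (S : list (Cube n -> Cube n)) : Prop :=
  (forall s, In s S -> InNV n s) /\ (forall g, InNV n g -> generated n S g).

Definition cay_adj (n : nat) (S : list (Cube n -> Cube n)) (g h : Cube n -> Cube n) : Prop :=
  InNV n g /\ InNV n h /\
  exists s, In s S /\ (h = (fun x => g (s x)) \/ g = (fun x => h (s x))).

Definition within (n : nat) (S : list (Cube n -> Cube n)) (N : nat) (g : Cube n -> Cube n) : Prop :=
  exists p, is_walk (cay_adj n S) (idf n :: p) /\ last p (idf n) = g /\ (length p <= N)%nat.

Definition conn_avoid (n : nat) (S : list (Cube n -> Cube n)) (K : list (Cube n -> Cube n))
    (x y : Cube n -> Cube n) : Prop :=
  exists p, is_walk (cay_adj n S) (x :: p) /\ last p x = y /\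
            Forall (fun z => ~ In z K) (x :: p).

Definition in_unbounded_comp (n : nat) (S : list (Cube n -> Cube n)) (K : list (Cube n -> Cube n))
    (x : Cube n -> Cube n) : Prop :=
  InNV n x /\ ~ In x K /\
  forall N, exists y, conn_avoid n S K x y /\ ~ within n S N y.

(* e = 1: sup over finite K of the number of unbounded components of Gamma - K is 1 *)
Definition ends_eq_one (n : nat) (S : list (Cube n -> Cube n)) : Prop :=
  (forall K x y, in_unbounded_comp n S K x -> in_unbounded_comp n S K y ->
                 conn_avoid n S K x y) /\
  (exists K x, in_unbounded_comp n S K x).

(* Main.v *)
(* An element of nV is determined by its effect on small dyadic bricks, and nV is generated by the
   involutions that swap two disjoint bricks; even finitely many swaps suffice, each supported in two
   of the eight strips cut out by the first three binary digits of the coordinate 0.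

   Property FA. A swap has finite order, hence fixes a vertex of the tree. Let g, h be two of the
   generating swaps. A permutation of the strips conjugates them to swaps g', h' whose supports avoid
   those of g and h, so g' and h' preserve the fixed subtrees Fix g and Fix h. If these subtrees were
   disjoint, then g' and h' would both fix the vertex of Fix g closest to Fix h; conjugating back, g
   and h would have a common fixed vertex after all. By the Helly property of subtrees the finitely
   many generators have a common fixed vertex.

   Ends. Let A be a set of group elements such that A and A g differ by a finite set for every g
   (a component of the Cayley graph minus a finite set is one). For h of infinite order, the sequence
   z h^i is eventually in A or eventually outside A. Its limit is unchanged when z is replaced by z k
   with k commuting with h, and it is the same for two independent commuting h, h'. Taking for h the
   elements supported in single strips, the limit depends neither on h nor on z, and this forces A to
   be finite or cofinite. *)
Require Import Defs.
From Stdlib Require Import Reals List ZArith Classical.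
From Stdlib Require Import Lra Lia Arith Bool Permutation.
From Stdlib Require Import FunctionalExtensionality ProofIrrelevance ClassicalEpsilon.
Import ListNotations.
Local Open Scope nat_scope.

(** * Dyadic words *)

(** The obstacle to generation by swaps is direction: a swap carries the halves of a brick in
    coordinate [k] to halves in the same coordinate, while two patterns with equally many bricks may
    have been halved in different coordinates. What is missing is the element that turns the halving
    of one brick in direction [k] into its halving in direction [l]. Two opposite changes on
    disjoint bricks are just three swaps; a single one is extracted because halving in [k] and [l]
    gives the same four quarters in either order. Moreover, from dimension three on a partition into
    bricks need not arise by repeated halving, so images of patterns are compared only after
    refinement to a uniform grid.

    Eight strips are used because two swaps occupy up to four of them, and some translation of the
    three-digit words moves all four off themselves; a spare third strip also serves as the
    intermediate place in conjugations.

    If all limits lie outside $A$, every element of $A$ leaves $A$ under powers of one $h$ through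
    the finite set where $A$ changes under $h$, and from there only boundedly many steps back by
    $h^{-1}$ can return to $A$. *)

Fixpoint ev (w : list bool) (t : R) : R :=
  match w with
  | [] => t
  | s :: w' => (((if s then 1 else 0) + ev w' t) / 2)%R
  end.

Lemma ev_app w v t : ev (w ++ v) t = ev w (ev v t).
Proof. induction w as [|s w IH]; simpl; [reflexivity|now rewrite IH]. Qed.

Lemma ev_affine w t : ev w t = (ev w 0 + (/ 2) ^ length w * t)%R.
Proof.
  induction w as [|s w IH]; simpl; [ring|].
  rewrite IH. destruct s; field.
Qed.

Lemma half_pow_pos m : (0 < (/ 2) ^ m)%R.
Proof. apply pow_lt. lra. Qed.

Lemma ev_range w t : (0 <= t < 1 -> 0 <= ev w t < 1)%R.
Proof. intro Ht. induction w as [|s w IH]; simpl; [lra|]. destruct s; lra. Qed.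

Lemma ev_inj w t t' : ev w t = ev w t' -> t = t'.
Proof.
  rewrite (ev_affine w t), (ev_affine w t'). intro H.
  apply Rmult_eq_reg_l with ((/ 2) ^ length w)%R; [lra|].
  pose proof (half_pow_pos (length w)). lra.
Qed.

Lemma ev_lt w t t' : (ev w t < ev w t' <-> t < t')%R.
Proof.
  induction w as [|s w IH]; simpl; [tauto|].
  rewrite <- IH. destruct s; split; intro; lra.
Qed.

Lemma ev_le w t t' : (ev w t <= ev w t' <-> t <= t')%R.
Proof.
  pose proof (ev_lt w t' t) as H. split; intro L; apply Rnot_lt_le; intro L'.
  - apply H in L'. lra.
  - apply H in L'. lra.
Qed.

(** [ev w] is the chart of $[0,1)$ onto the numbers whose binary digits begin with [w]. Half-open
    intervals make the digits of a common value unambiguous, so dyadic intervals that meet are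
    nested. *)
Lemma ev_prefix w : forall w' t t', (0 <= t < 1)%R -> (0 <= t' < 1)%R ->
  ev w t = ev w' t' -> length w <= length w' -> exists v, w' = w ++ v.
Proof.
  induction w as [|s w IH]; intros w' t t' Ht Ht' E L.
  - now exists w'.
  - destruct w' as [|s' w']; simpl in *; [lia|].
    pose proof (ev_range w t Ht). pose proof (ev_range w' t' Ht').
    assert (s = s') as <- by (destruct s, s'; auto; lra).
    destruct (IH w' t t') as [v ->]; auto; [destruct s; lra|lia|].
    now exists v.
Qed.

Lemma ev_cover m : forall t, (0 <= t < 1)%R ->
  exists w t', length w = m /\ (0 <= t' < 1)%R /\ t = ev w t'.
Proof.
  induction m as [|m IH]; intros t Ht.
  - exists [], t. auto.
  - destruct (Rlt_or_le t (/ 2)) as [H|H].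
    + destruct (IH (2 * t)%R) as (w & t' & L & R & E); [lra|].
      exists (false :: w), t'. simpl. rewrite <- E. repeat split; auto; lra.
    + destruct (IH (2 * t - 1)%R) as (w & t' & L & R & E); [lra|].
      exists (true :: w), t'. simpl. rewrite <- E. repeat split; auto; lra.
Qed.

(** * Bricks and their charts *)

(* Only the words in coordinates [k < n] matter: the charts below ignore the others. *)
Definition brick : Type := nat -> list bool.
Definition bapp (b c : brick) : brick := fun k => b k ++ c k.
Definition letter (k : nat) (s : bool) : brick := fun i => if i =? k then [s] else [].
Definition whole : brick := fun _ => [].

Lemma pt_range {n} (x : Cube n) k : k < n -> (0 <= pt x k < 1)%R.
Proof. destruct x as [x [H H']]. apply H. Qed.

Lemma cube_ext {n} (x y : Cube n) : (forall k, k < n -> pt x k = pt y k) -> x = y.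
Proof.
  destruct x as [x Hx], y as [y Hy]. unfold pt; simpl. intro H.
  assert (x = y) as <-.
  { extensionality k. destruct (lt_dec k n) as [L|L]; [auto|].
    destruct Hx as [_ Hx], Hy as [_ Hy]. rewrite Hx, Hy; auto; lia. }
  f_equal. apply proof_irrelevance.
Qed.

Lemma cube_of n (f : nat -> R) : (forall k, k < n -> (0 <= f k < 1)%R) ->
  exists x : Cube n, forall k, k < n -> pt x k = f k.
Proof.
  intro H. assert (C : in_cube n (fun k => if k <? n then f k else 0%R)).
  { split; intros k Hk; destruct (Nat.ltb_spec k n); auto; lia. }
  exists (exist _ _ C). intros k Hk. unfold pt; simpl.
  destruct (Nat.ltb_spec k n); auto; lia.
Qed.

Lemma phi_in_cube {n} (b : brick) (x : Cube n) :
  in_cube n (fun k => if k <? n then ev (b k) (pt x k) else 0%R).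
Proof.
  split; intros k Hk; destruct (Nat.ltb_spec k n); try lia; auto.
  apply ev_range, pt_range; auto.
Qed.

(** The affine chart of the cube onto a brick. With charts, an affine map between bricks reads
    [f (phi b x) = phi c x], and no slopes or offsets appear. *)
Definition phi {n} (b : brick) (x : Cube n) : Cube n := exist _ _ (phi_in_cube b x).

Lemma pt_phi {n} b (x : Cube n) k : k < n -> pt (phi b x) k = ev (b k) (pt x k).
Proof. intro H. unfold pt at 1; simpl. destruct (Nat.ltb_spec k n); auto; lia. Qed.

Arguments phi : simpl never.

Section Charts.
Context {n : nat}.
Implicit Types (b c u v w : brick) (x y : Cube n).

Lemma phi_app b c x : phi (bapp b c) x = phi b (phi c x).
Proof. apply cube_ext. intros k Hk. rewrite !pt_phi by auto. apply ev_app. Qed.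

Lemma phi_inj b x y : phi b x = phi b y -> x = y.
Proof.
  intro H. apply cube_ext. intros k Hk. apply ev_inj with (b k).
  rewrite <- !pt_phi by auto. now rewrite H.
Qed.

Lemma phi_eqv b c x : (forall k, k < n -> b k = c k) -> phi b x = phi c x.
Proof. intro H. apply cube_ext. intros k Hk. rewrite !pt_phi by auto. now rewrite H. Qed.

Lemma phi_whole x : phi whole x = x.
Proof. apply cube_ext. intros k Hk. now rewrite pt_phi by auto. Qed.

Lemma phi_prefix b c x y : phi b x = phi c y ->
  (forall k, k < n -> length (b k) <= length (c k)) ->
  exists v, forall k, k < n -> c k = b k ++ v k.
Proof.
  intros E L.
  assert (H : forall k, exists e : list bool, k < n -> c k = b k ++ e).
  { intro k. destruct (lt_dec k n) as [Hk|Hk]; [|exists []; lia].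
    destruct (ev_prefix (b k) (c k) (pt x k) (pt y k)) as [v Hv].
    - now apply pt_range.
    - now apply pt_range.
    - rewrite <- !pt_phi by auto. now rewrite E.
    - auto.
    - now exists v. }
  apply choice in H. exact H.
Qed.

Lemma phi_sub b c x y : phi b x = phi c y ->
  (forall k, k < n -> length (b k) <= length (c k)) ->
  exists v, forall z : Cube n, phi c z = phi b (phi v z).
Proof.
  intros E L. destruct (phi_prefix b c x y E L) as [v Hv]. exists v. intro z.
  rewrite <- phi_app. now apply phi_eqv.
Qed.

(** Reading off the leading [m k] binary digits in each coordinate finds the grid cell of [x]. The
    empty words beyond [n] give each cell a single representative. *)
Lemma phi_cover (m : nat -> nat) x : exists b y, x = phi b y /\
  (forall k, k < n -> length (b k) = m k) /\ (forall k, n <= k -> b k = []).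
Proof.
  assert (H : forall k, exists p : list bool * R, (k < n -> length (fst p) = m k /\
    (0 <= snd p < 1)%R /\ pt x k = ev (fst p) (snd p)) /\ (n <= k -> fst p = [])).
  { intro k. destruct (lt_dec k n) as [Hk|Hk]; [|exists ([], 0%R); split; auto; lia].
    destruct (ev_cover (m k) (pt x k) (pt_range x k Hk)) as (w & t & ?).
    exists (w, t). split; auto; lia. }
  apply choice in H. destruct H as [f Hf].
  destruct (cube_of n (fun k => snd (f k))) as [y Hy]; [apply Hf|].
  exists (fun k => fst (f k)), y. repeat split; try apply Hf.
  apply cube_ext. intros k Hk. rewrite pt_phi, Hy by auto. now apply Hf.
Qed.

Lemma phi_cut b (m : nat -> nat) : exists u v,
  (forall x, phi b x = phi u (phi v x)) /\
  (forall k, length (u k) = Nat.min (m k) (length (b k))) /\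
  (forall k, length (v k) = length (b k) - m k).
Proof.
  exists (fun k => firstn (m k) (b k)), (fun k => skipn (m k) (b k)). repeat split.
  - intro x. rewrite <- phi_app. apply phi_eqv. intros k _. symmetry. apply firstn_skipn.
  - intro k. apply length_firstn.
  - intro k. apply length_skipn.
Qed.

Lemma phi_letter_disj k s s' x y : k < n ->
  phi (letter k s) x = phi (letter k s') y -> s = s'.
Proof.
  intros Hk E. assert (F : pt (phi (letter k s) x) k = pt (phi (letter k s') y) k) by now rewrite E.
  rewrite !pt_phi in F by auto. unfold letter in F. rewrite Nat.eqb_refl in F. simpl in F.
  pose proof (pt_range x k Hk). pose proof (pt_range y k Hk).
  destruct s, s'; auto; lra.
Qed.

Lemma phi_letter_cover k x : k < n -> exists s y, x = phi (letter k s) y.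
Proof.
  intro Hk. destruct (phi_cover (fun i => if i =? k then 1 else 0) x) as (b & y & E & L & _).
  assert (Lk := L k Hk). rewrite Nat.eqb_refl in Lk.
  destruct (b k) as [|s [|]] eqn:Ek; simpl in Lk; try lia.
  exists s, y. rewrite E. apply phi_eqv. intros i Hi. unfold letter.
  destruct (Nat.eqb_spec i k) as [->|Ne]; auto.
  specialize (L i Hi). apply Nat.eqb_neq in Ne. rewrite Ne in L.
  now apply length_zero_iff_nil.
Qed.

Lemma phi_letter_comm k l s t x : k <> l ->
  phi (letter k s) (phi (letter l t) x) = phi (letter l t) (phi (letter k s) x).
Proof.
  intro Ne. rewrite <- !phi_app. apply phi_eqv. intros i _. unfold bapp, letter.
  destruct (Nat.eqb_spec i k), (Nat.eqb_spec i l); auto; congruence.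
Qed.

Definition origin : Cube n :=
  exist _ (fun _ => 0%R) (conj (fun _ _ => conj (Rle_refl 0) Rlt_0_1) (fun _ _ => eq_refl)).

Definition covers (b : brick) (x : Cube n) : Prop := exists y, x = phi b y.
Definition disj b c : Prop := forall x y : Cube n, phi b x <> phi c y.

Lemma covers_phi b y : covers b (phi b y).
Proof. now exists y. Qed.

Lemma disj_sym b c : disj b c -> disj c b.
Proof. intros H x y E. now apply (H y x). Qed.

Lemma disj_app_l b u c : disj b c -> disj (bapp b u) c.
Proof. intros H x y. rewrite phi_app. apply H. Qed.

Lemma disj_app_r b u c : disj c b -> disj c (bapp b u).
Proof. intros H x y. rewrite phi_app. apply H. Qed.

Lemma disj_app z b c : disj b c -> disj (bapp z b) (bapp z c).
Proof. intros H x y. rewrite !phi_app. intro E. now apply phi_inj, H in E. Qed.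

Lemma disj_letter k s s' : k < n -> s <> s' -> disj (letter k s) (letter k s').
Proof. intros Hk Ne x y E. now apply phi_letter_disj in E. Qed.

Lemma disj_covers b c x : disj b c -> covers b x -> covers c x -> False.
Proof. intros D [y ->] [z E]. now apply (D y z). Qed.

Lemma disj_irrefl b : ~ disj b b.
Proof. intro D. now apply (D origin origin). Qed.

Lemma disj_nested_or_apart b c : (forall k, k < n -> length (b k) <= length (c k)) ->
  disj b c \/ exists v, forall z : Cube n, phi c z = phi b (phi v z).
Proof.
  intro L. destruct (classic (disj b c)) as [D|D]; auto. right.
  apply not_all_ex_not in D as [x D]. apply not_all_ex_not in D as [y D].
  apply NNPP in D. now apply phi_sub with x y.
Qed.

End Charts.

(** * Brick-wise affine bijections *)

Lemma words_list N : exists l : list (list bool), forall w, length w <= N -> In w l.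
Proof.
  induction N as [|N [l Hl]].
  - exists [[]]. intros [|s w] H; simpl in *; [auto|lia].
  - exists ([] :: map (cons true) l ++ map (cons false) l).
    intros [|s w] H; simpl in *; [auto|right].
    apply in_or_app. destruct s; [left|right]; apply in_map, Hl; lia.
Qed.

Lemma bricks_list n N : exists l : list brick, forall b,
  (forall k, k < n -> length (b k) <= N) -> exists b', In b' l /\ forall k, k < n -> b k = b' k.
Proof.
  destruct (words_list N) as [W HW]. induction n as [|n [l Hl]].
  - exists [whole]. intros b _. exists whole. split; [now left|lia].
  - exists (map (fun p i => if i =? n then fst p else snd p i) (list_prod W l)).
    intros b Hb. destruct (Hl b) as (b' & In' & E); [auto|].
    exists (fun i => if i =? n then b n else b' i). split.
    + apply in_map_iff. exists (b n, b'). split; auto. apply in_prod; auto.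
    + intros k Hk. destruct (Nat.eqb_spec k n) as [->|]; auto. apply E. lia.
Qed.

Lemma brick_bound n (b : brick) : exists M, forall k, k < n -> length (b k) <= M.
Proof.
  induction n as [|n [M HM]]; [exists 0; lia|].
  exists (M + length (b n)). intros k Hk.
  destruct (Nat.eq_dec k n) as [->|]; [lia|]. specialize (HM k). lia.
Qed.

Section Group.
Context {n : nat}.
Implicit Types (b c d v w : brick) (x y : Cube n) (f g h : Cube n -> Cube n).

(** A depth bound in place of an explicit pattern: no disjointness and no common refinement has to
    be carried along under composition. *)
Definition locally_affine f : Prop :=
  exists L, forall b, (forall k, k < n -> L <= length (b k)) ->
    exists c, forall x, f (phi b x) = phi c x.

Definition NV f : Prop :=
  locally_affine f /\ (forall x y, f x = f y -> x = y) /\ (forall y, exists x, f x = y).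

Lemma NV_comp f g : NV f -> NV g -> NV (fun x => f (g x)).
Proof.
  intros ([L HL] & If & Sf) ([M HM] & Ig & Sg). repeat split.
  (* The leading [M] digits suffice for [g] to act by a chart; the remaining ones, at least [L],
     survive as a tail, so the image is deep enough for [f]. *)
  - exists (M + L). intros b Hb. destruct (phi_cut (n := n) b (fun _ => M)) as (u & v & E & Lu & Lv).
    destruct (HM u) as [c Hc]; [intros k Hk; rewrite Lu; specialize (Hb k Hk); lia|].
    destruct (HL (bapp c v)) as [d Hd].
    { intros k Hk. unfold bapp. rewrite length_app, Lv. specialize (Hb k Hk). lia. }
    exists d. intro x. now rewrite E, Hc, <- phi_app, Hd.
  - auto.
  - intro y. destruct (Sf y) as [z <-]. destruct (Sg z) as [x <-]. eauto.
Qed.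

Lemma NV_id : NV (fun x => x).
Proof. repeat split; eauto. exists 0. intros b _. now exists b. Qed.

(** Up to the words beyond [n] there are finitely many bricks of depth exactly [L], hence a uniform
    bound for the depth of their images. Inverses and image grids depend on it. *)
Lemma affine_bound f L : (forall b, (forall k, k < n -> L <= length (b k)) ->
    exists c, forall x, f (phi b x) = phi c x) ->
  exists M, forall b, (forall k, k < n -> length (b k) = L) ->
    exists c, (forall x, f (phi b x) = phi c x) /\ forall k, k < n -> length (c k) <= M.
Proof.
  intro HL. destruct (bricks_list n L) as [l Hl].
  assert (HB : exists M, forall b, In b l -> (forall k, k < n -> length (b k) = L) ->
    exists c, (forall x, f (phi b x) = phi c x) /\ forall k, k < n -> length (c k) <= M).
  { clear Hl. induction l as [|a l [M HM]]; [exists 0; intros b []|].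
    destruct (classic (forall k, k < n -> length (a k) = L)) as [Ha|Ha].
    - destruct (HL a) as [c Hc]; [intros k Hk; rewrite Ha; auto|].
      destruct (brick_bound n c) as [M' HM']. exists (M + M'). intros b [<-|Hb] Lb.
      + exists c. split; auto. intros k Hk. specialize (HM' k Hk). lia.
      + destruct (HM b Hb Lb) as (d & Hd & Ld). exists d. split; auto.
        intros k Hk. specialize (Ld k Hk). lia.
    - exists M. intros b [<-|Hb] Lb; [contradiction|auto]. }
  destruct HB as [M HM]. exists M. intros b Lb.
  destruct (Hl b) as (b' & Hb' & E); [intros k Hk; rewrite Lb; auto|].
  destruct (HM b' Hb') as (c & Hc & Lc); [intros k Hk; rewrite <- E; auto|].
  exists c. split; auto. intro x. now rewrite (phi_eqv b b' x E).
Qed.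

Lemma NV_inv f : NV f -> exists g, NV g /\ (forall x, g (f x) = x) /\ (forall x, f (g x) = x).
Proof.
  intros ([L HL] & If & Sf). pose proof Sf as Sf'. apply choice in Sf'. destruct Sf' as [g Hg].
  assert (Hg' : forall x, g (f x) = x) by (intro x; apply If; now rewrite Hg).
  exists g. repeat split; auto.
  (* A brick of depth at least [M] meets the image [c] of some cell of depth [L]. It is at least as
     deep as [c], hence lies inside, and its tail is transferred back to the cell. *)
  - destruct (affine_bound f L HL) as [M HM]. exists M. intros b Hb.
    destruct (phi_cover (fun _ => L) (g (phi b origin))) as (u & y & E & Lu & _).
    destruct (HM u Lu) as (c & Hc & Lc).
    destruct (phi_sub c b y origin) as [v Hv].
    + now rewrite <- Hc, <- E, Hg.
    + intros k Hk. specialize (Hb k Hk). specialize (Lc k Hk). lia.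
    + exists (bapp u v). intro x. now rewrite Hv, <- Hc, Hg', phi_app.
  - intros x y E. rewrite <- (Hg x), <- (Hg y). now f_equal.
  - eauto.
Qed.

(** * Swaps of disjoint bricks *)

Definition swap_graph b c x y : Prop :=
  (exists u, x = phi b u /\ y = phi c u) \/ (exists u, x = phi c u /\ y = phi b u) \/
  (~ covers b x /\ ~ covers c x /\ y = x).

(** Choosing from the graph avoids deciding membership in a brick. The result is a total map for all
    bricks, and the intended involution when they are disjoint. *)
Definition sw b c x : Cube n := epsilon (inhabits x) (swap_graph b c x).

Lemma sw_graph b c x : swap_graph b c x (sw b c x).
Proof.
  unfold sw. apply epsilon_spec. unfold swap_graph.
  destruct (classic (covers b x)) as [[u ->]|Hb]; [eauto 6|].
  destruct (classic (covers c x)) as [[u ->]|Hc]; eauto 6.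
Qed.

Lemma sw_l b c x : disj (n := n) b c -> sw b c (phi b x) = phi c x.
Proof.
  intro D. destruct (sw_graph b c (phi b x)) as [(u & E & ->)|[(u & E & _)|(H & _)]].
  - now apply phi_inj in E as <-.
  - now apply D in E.
  - destruct H. apply covers_phi.
Qed.

Lemma sw_r b c x : disj (n := n) b c -> sw b c (phi c x) = phi b x.
Proof.
  intro D. destruct (sw_graph b c (phi c x)) as [(u & E & _)|[(u & E & ->)|(_ & H & _)]].
  - symmetry in E. now apply D in E.
  - now apply phi_inj in E as <-.
  - destruct H. apply covers_phi.
Qed.

Lemma sw_off b c x : ~ covers b x -> ~ covers c x -> sw b c x = x.
Proof.
  intros Hb Hc. destruct (sw_graph b c x) as [(u & E & _)|[(u & E & _)|(_ & _ & E)]]; auto.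
  - destruct Hb. now exists u.
  - destruct Hc. now exists u.
Qed.

Lemma sw_out b c d x : disj (n := n) b d -> disj (n := n) c d -> sw b c (phi d x) = phi d x.
Proof.
  intros Db Dc. apply sw_off; intros [y E]; symmetry in E; [now apply Db in E|now apply Dc in E].
Qed.

Lemma sw_elim b c (Q : Cube n -> Prop) : (forall x, Q (phi b x)) -> (forall x, Q (phi c x)) ->
  (forall x, ~ covers b x -> ~ covers c x -> Q x) -> forall x, Q x.
Proof.
  intros Hb Hc Ho x. destruct (classic (covers b x)) as [[u ->]|Nb]; auto.
  destruct (classic (covers c x)) as [[u ->]|Nc]; auto.
Qed.

Lemma sw_invol b c x : disj (n := n) b c -> sw b c (sw b c x) = x.
Proof.
  intro D. revert x. apply (sw_elim b c); intros.
  - now rewrite sw_l, sw_r.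
  - now rewrite sw_r, sw_l.
  - now rewrite !sw_off by (rewrite ?sw_off; auto).
Qed.

Lemma NV_sw b c : disj (n := n) b c -> NV (sw b c).
Proof.
  intro D. repeat split.
  - destruct (brick_bound n b) as [M HM], (brick_bound n c) as [M' HM'].
    exists (M + M'). intros d Hd.
    destruct (disj_nested_or_apart (n := n) b d) as [Db|[v Hv]].
    { intros k Hk. specialize (HM k Hk). specialize (Hd k Hk). lia. }
    2:{ exists (bapp c v). intro x. now rewrite Hv, sw_l, phi_app. }
    destruct (disj_nested_or_apart (n := n) c d) as [Dc|[v Hv]].
    { intros k Hk. specialize (HM' k Hk). specialize (Hd k Hk). lia. }
    2:{ exists (bapp b v). intro x. now rewrite Hv, sw_r, phi_app. }
    exists d. intro x. now apply sw_out.
  - intros x y E. rewrite <- (sw_invol b c x D), <- (sw_invol b c y D). now f_equal.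
  - intro y. exists (sw b c y). now apply sw_invol.
Qed.

Inductive swap_products (P : brick -> brick -> Prop) : (Cube n -> Cube n) -> Prop :=
| swap_products_id : swap_products P (fun x => x)
| swap_products_sw b c g : P b c -> disj (n := n) b c -> swap_products P g ->
    swap_products P (fun x => sw b c (g x)).

Lemma swap_products_ext P f g : (forall x, f x = g x) -> swap_products P f -> swap_products P g.
Proof. intros E. now replace g with f by (extensionality x; auto). Qed.

Lemma swap_products_comp P f g : swap_products P f -> swap_products P g ->
  swap_products P (fun x => f (g x)).
Proof.
  intros Hf Hg. induction Hf as [|b c f Pbc D Hf IH]; [now apply swap_products_ext with g|].
  now apply (swap_products_sw P b c (fun x => f (g x))).
Qed.

Lemma swap_products_one (P : brick -> brick -> Prop) b c :
  P b c -> disj (n := n) b c -> swap_products P (sw b c).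
Proof. intros. apply (swap_products_sw P b c (fun x => x)); auto. constructor. Qed.

Lemma swap_products_bind (P Q : brick -> brick -> Prop) g :
  (forall b c, P b c -> disj (n := n) b c -> swap_products Q (sw b c)) ->
  swap_products P g -> swap_products Q g.
Proof.
  intros HPQ Hg. induction Hg as [|b c g Pbc D Hg IH]; [constructor|].
  apply (swap_products_comp Q (sw b c) g); auto.
Qed.

Lemma swap_products_NV P g : swap_products P g -> NV g.
Proof.
  induction 1 as [|b c g Pbc D Hg IH]; [apply NV_id|].
  apply (NV_comp (sw b c) g); auto using NV_sw.
Qed.

End Group.

(** * Swaps generate *)

Section Generation.
Context {n : nat}.
Implicit Types (b c d p q v w z : brick) (x y : Cube n) (f g h : Cube n -> Cube n).

Definition is_swap_product : (Cube n -> Cube n) -> Prop := swap_products (fun _ _ => True).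

Lemma is_swap_product_sw b c : disj (n := n) b c -> is_swap_product (sw b c).
Proof. intro D. now apply swap_products_one. Qed.

Lemma is_swap_product_comp f g :
  is_swap_product f -> is_swap_product g -> is_swap_product (fun x => f (g x)).
Proof. apply swap_products_comp. Qed.

Lemma covers_app b v x : covers (bapp b v) x -> covers b x.
Proof. intros [y ->]. rewrite phi_app. apply covers_phi. Qed.

Lemma disj_not_covers b d x : disj (n := n) b d -> ~ covers b (phi d x).
Proof. intros D H. eapply disj_covers; eauto using covers_phi. Qed.

Lemma disj_letter_bool k s : k < n -> disj (n := n) (letter k s) (letter k (negb s)).
Proof. intro Hk. apply disj_letter; auto. now destruct s. Qed.

Lemma disj_letter_ft k : k < n -> disj (n := n) (letter k false) (letter k true).
Proof. intro Hk. now apply disj_letter. Qed.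

Lemma disj_letter_tf k : k < n -> disj (n := n) (letter k true) (letter k false).
Proof. intro Hk. now apply disj_letter. Qed.

Hint Resolve disj_app_l disj_app_r disj_app disj_letter_ft disj_letter_tf disj_sym
  disj_not_covers covers_app : disj.

Lemma sw_at_l b c x y : disj (n := n) b c -> y = phi b x -> sw b c y = phi c x.
Proof. intros D ->. now apply sw_l. Qed.

Lemma sw_at_r b c x y : disj (n := n) b c -> y = phi c x -> sw b c y = phi b x.
Proof. intros D ->. now apply sw_r. Qed.

Lemma sw_at_out b c d x y : disj (n := n) b d -> disj (n := n) c d -> y = phi d x -> sw b c y = y.
Proof. intros Db Dc ->. now apply sw_out. Qed.

(** A baker-type map inside [z], exchanging one direction of halving for another; nothing is said
    outside [z]. *)
Definition retypes k l z h : Prop :=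
  forall s x, h (phi z (phi (letter k s) x)) = phi z (phi (letter l s) x).

(** The two swaps of halves send $zk_s$ to $pl_s$, and swapping [z] with [p] brings this back as
    $zl_s$. The same three swaps make the reverse change on [p]. *)
Lemma opposite_retyping k l z p : k < n -> l < n -> disj (n := n) z p ->
  exists h, is_swap_product h /\ retypes k l z h /\ retypes l k p h /\
    forall x, ~ covers z x -> ~ covers p x -> h x = x.
Proof.
  intros Hk Hl D. assert (D' := disj_sym _ _ D).
  exists (fun x => sw z p (sw (bapp z (letter k true)) (bapp p (letter l true))
                 (sw (bapp z (letter k false)) (bapp p (letter l false)) x))).
  repeat split.
  - apply (is_swap_product_comp (sw z p)); [now apply is_swap_product_sw|].
    apply (is_swap_product_comp (sw (bapp z (letter k true)) (bapp p (letter l true))));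
      apply is_swap_product_sw; auto with disj.
  - intros [|] x; rewrite <- phi_app.
    + rewrite (sw_at_out (bapp z (letter k false)) _ (bapp z (letter k true)) x) by auto with disj.
      rewrite sw_l, phi_app, sw_r; auto with disj.
    + rewrite sw_l by auto with disj.
      rewrite (sw_at_out (bapp z (letter k true)) _ (bapp p (letter l false)) x) by auto with disj.
      rewrite phi_app, sw_r; auto.
  - intros [|] x; rewrite <- phi_app.
    + rewrite (sw_at_out (bapp z (letter k false)) _ (bapp p (letter l true)) x) by auto with disj.
      rewrite sw_r, phi_app, sw_l; auto with disj.
    + rewrite sw_r by auto with disj.
      rewrite (sw_at_out (bapp z (letter k true)) _ (bapp z (letter k false)) x) by auto with disj.
      rewrite phi_app, sw_l; auto.
  - intros x Hz Hp. rewrite (sw_off (bapp z (letter k false))) by eauto with disj.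
    rewrite (sw_off (bapp z (letter k true))) by eauto with disj. now apply sw_off.
Qed.

(* Let [t] retype [p], let [u] retype [z] and undo [t], and let [u0], [u1] do so for the two halves
   of [z]. The retyping of [z] factors through those of its halves and a swap [s], that is
   [s u0 t u1 t = u t]; hence [t = u0^-1 s u u1^-1] is a product of swaps. Below, [h0] and [h1] are
   the inverses of [u0] and [u1]. *)
Lemma retyping_beside k l z p : k < n -> l < n -> k <> l -> disj (n := n) z p ->
  exists h, is_swap_product h /\ retypes k l p h /\ forall x, ~ covers p x -> h x = x.
Proof.
  intros Hk Hl Ne D. assert (D' := disj_sym _ _ D).
  destruct (opposite_retyping k l p (bapp z (letter k true))) as (h1 & S1 & P1 & Z1 & O1);
    auto with disj.
  destruct (opposite_retyping k l z p) as (h & S & Z & P & O); auto.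
  destruct (opposite_retyping k l p (bapp z (letter k false))) as (h0 & S0 & P0 & Z0 & O0);
    auto with disj.
  (* Among the four quarters $zk_sl_t$, exchanging the digits $s$ and $t$ interchanges just the two
     mixed ones, [b] and [c]; their swap makes up the difference between retyping [z] and retyping
     its halves. *)
  set (b := bapp z (bapp (letter k false) (letter l true))).
  set (c := bapp z (bapp (letter k true) (letter l false))).
  assert (Dbc : disj (n := n) b c) by (unfold b, c; auto with disj).
  assert (Eb : forall x, phi z (phi (letter k false) (phi (letter l true) x)) = phi b x).
  { intro x. unfold b. now rewrite !phi_app. }
  assert (Ec : forall x, phi z (phi (letter k true) (phi (letter l false) x)) = phi c x).
  { intro x. unfold c. now rewrite !phi_app. }
  exists (fun x => h0 (sw b c (h (h1 x)))). repeat split.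
  - apply (is_swap_product_comp h0 (fun x => sw b c (h (h1 x)))); auto.
    apply (is_swap_product_comp (sw b c) (fun x => h (h1 x))); [now apply is_swap_product_sw|].
    now apply is_swap_product_comp.
  - intros s x. rewrite P1, P, (sw_at_out _ _ p (phi (letter k s) x)); auto;
      unfold b, c; auto with disj.
  - intros x Hp. destruct (classic (covers z x)) as [[x1 ->]|Hz].
    2:{ rewrite O1, O, sw_off, O0; unfold b, c; eauto with disj. }
    destruct (phi_letter_cover k x1 Hk) as ([|] & x2 & ->).
    + destruct (phi_letter_cover l x2 Hl) as (t & x3 & ->).
      rewrite <- (phi_app z), Z1, phi_app, Z, phi_letter_comm by auto.
      destruct t.
      * rewrite (sw_at_out _ _ (bapp z (bapp (letter k true) (letter l true))) x3).
        -- rewrite O0; auto.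
           ++ rewrite <- phi_app. auto with disj.
           ++ rewrite <- (phi_app z). auto with disj.
        -- unfold b; auto with disj.
        -- unfold c; auto with disj.
        -- now rewrite !phi_app.
      * rewrite Eb, sw_l by auto. rewrite <- Ec, O0; auto; rewrite <- (phi_app z); auto with disj.
    + rewrite O1; [|auto|].
      2:{ rewrite <- (phi_app z). auto with disj. }
      rewrite Z. destruct (phi_letter_cover k x2 Hk) as (t & x3 & ->).
      rewrite phi_letter_comm by auto. destruct t.
      * rewrite Ec, sw_r, <- Eb by auto. rewrite <- (phi_app z), Z0. now rewrite phi_app.
      * rewrite (sw_at_out _ _ (bapp z (bapp (letter k false) (letter l false))) x3).
        -- rewrite <- (phi_app z), Z0. now rewrite phi_app.
        -- unfold b; auto with disj.
        -- unfold c; auto with disj.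
        -- now rewrite !phi_app.
Qed.

(** The two halves of [q] serve as each other's outside brick, so no room beyond [q] is needed and
    even the whole cube is allowed. Once both are retyped, $qk_sk_t$ has become $qk_sl_t$; swapping
    the mixed quarters turns it into $qk_tl_s=ql_sk_t$. *)
Lemma retyping k l q : k < n -> l < n ->
  exists h, is_swap_product h /\ retypes k l q h /\ forall x, ~ covers q x -> h x = x.
Proof.
  intros Hk Hl. destruct (Nat.eq_dec k l) as [<-|Ne].
  { exists (fun x => x). repeat split; auto. constructor. }
  destruct (retyping_beside k l (bapp q (letter k true)) (bapp q (letter k false)))
    as (h0 & S0 & P0 & O0); auto with disj.
  destruct (retyping_beside k l (bapp q (letter k false)) (bapp q (letter k true)))
    as (h1 & S1 & P1 & O1); auto with disj.
  set (b := bapp q (bapp (letter k false) (letter l true))).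
  set (c := bapp q (bapp (letter k true) (letter l false))).
  assert (Dbc : disj (n := n) b c) by (unfold b, c; auto with disj).
  exists (fun x => sw b c (h0 (h1 x))). repeat split.
  - apply (is_swap_product_comp (sw b c) (fun x => h0 (h1 x))); [now apply is_swap_product_sw|].
    now apply is_swap_product_comp.
  - intros s x. destruct (phi_letter_cover k x Hk) as (t & x1 & ->).
    rewrite <- (phi_letter_comm k l) by auto. rewrite <- (phi_app q).
    destruct s.
    + rewrite P1, O0 by (rewrite phi_app, <- phi_app; auto with disj).
      rewrite phi_app. destruct t.
      * apply (sw_at_out _ _ (bapp q (bapp (letter k true) (letter l true))) x1);
          [unfold b; auto with disj|unfold c; auto with disj|now rewrite !phi_app].
      * rewrite (sw_at_r _ _ x1); auto; [unfold b|unfold c]; now rewrite !phi_app.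
    + rewrite O1 by auto with disj. rewrite P0, phi_app. destruct t.
      * rewrite (sw_at_l _ _ x1); auto; [unfold c|unfold b]; now rewrite !phi_app.
      * apply (sw_at_out _ _ (bapp q (bapp (letter k false) (letter l false))) x1);
          [unfold b; auto with disj|unfold c; auto with disj|now rewrite !phi_app].
  - intros x Hx. rewrite O1, O0, sw_off; unfold b, c; eauto with disj.
Qed.

(** * Patterns obtained by halving *)

(** The order matters because patterns are matched entry by entry; the permutation rule brings the
    brick to be halved to the head. *)
Inductive halving : list brick -> Prop :=
| halving_whole : halving [whole]
| halving_split b l k : k < n -> halving (b :: l) ->
    halving (bapp b (letter k false) :: bapp b (letter k true) :: l)
| halving_perm l l' : Permutation l l' -> halving l -> halving l'.

Definition pairwise_disj (l : list brick) : Prop := ForallOrdPairs (disj (n := n)) l.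

Lemma pairwise_disj_cons b l :
  pairwise_disj (b :: l) <-> Forall (disj (n := n) b) l /\ pairwise_disj l.
Proof.
  split; [intro H; inversion H; auto|intros [H H']; now constructor].
Qed.

Lemma pairwise_disj_perm l l' : Permutation l l' -> pairwise_disj l -> pairwise_disj l'.
Proof.
  induction 1 as [|b l l' Hp IH|b c l|l1 l2 l3 _ IH1 _ IH2]; auto.
  - rewrite !pairwise_disj_cons. intros [H1 H2]. split; auto.
    now apply Permutation_Forall with l.
  - rewrite !pairwise_disj_cons. intros (H1 & H2 & H3).
    inversion H1; subst. auto with disj.
Qed.

Lemma halving_disj l : halving l -> pairwise_disj l.
Proof.
  induction 1 as [|b l k Hk _ IH|l l' Hp _ IH].
  - rewrite pairwise_disj_cons. split; constructor.
  - rewrite !pairwise_disj_cons in *. destruct IH as [H1 H2]. split; [constructor|split]; auto.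
    + auto with disj.
    + eapply Forall_impl; [|exact H1]. auto with disj.
    + eapply Forall_impl; [|exact H1]. auto with disj.
  - now apply pairwise_disj_perm with l.
Qed.

Lemma halving_covers l : halving l -> forall x, exists b, In b l /\ covers b x.
Proof.
  induction 1 as [|b l k Hk _ IH|l l' Hp _ IH]; intro x.
  - exists whole. split; [now left|]. exists x. now rewrite phi_whole.
  - destruct (IH x) as (c & [<-|Hc] & [y ->]).
    + destruct (phi_letter_cover k y Hk) as ([|] & z & ->); rewrite <- phi_app;
        eexists; (split; [|apply covers_phi]); simpl; auto.
    + exists c. split; [simpl; auto|apply covers_phi].
  - destruct (IH x) as (b & Hb & Cb). exists b. split; auto. now apply Permutation_in with l.
Qed.

(** Inversion with all trailing reorderings absorbed into one permutation, so that a last halving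
    can be undone. *)
Lemma halving_cases l : halving l -> l = [whole] \/
  exists b k l', k < n /\ halving (b :: l') /\
    Permutation (bapp b (letter k false) :: bapp b (letter k true) :: l') l.
Proof.
  induction 1 as [|b l k Hk H _|l l' Hp H IH]; [auto|right; eauto 6|].
  destruct IH as [->|(b & k & l0 & Hk & Hb & Hl)].
  - left. symmetry. now apply Permutation_length_1_inv in Hp.
  - right. exists b, k, l0. repeat split; auto. now transitivity l.
Qed.

Definition carries h (l l' : list brick) : Prop :=
  Forall2 (fun b c => forall x, h (phi b x) = phi c x) l l'.

Lemma carries_comp f g l1 l2 l3 : carries g l1 l2 -> carries f l2 l3 ->
  carries (fun x => f (g x)) l1 l3.
Proof.
  intro H. revert l3. induction H as [|b c l1 l2 E H IH]; intros l3 H3; inversion H3; subst;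
    constructor.
  - intro x. now rewrite E.
  - now apply IH.
Qed.

Lemma carries_fixed h l : (forall b x, In b l -> h (phi b x) = phi b x) -> carries h l l.
Proof.
  induction l as [|b l IH]; intro H; constructor.
  - intro x. apply H. now left.
  - apply IH. intros c x Hc. apply H. now right.
Qed.

Lemma permutation_carried l l' : Permutation l l' -> pairwise_disj l ->
  exists h, is_swap_product h /\ carries h l l' /\
    forall x, (forall b, In b l -> ~ covers b x) -> h x = x.
Proof.
  induction 1 as [|b l l' Hp IH|b c l|l1 l2 l3 H1 IH1 H2 IH2]; intro D.
  - exists (fun x => x). repeat split; auto; constructor.
  - apply pairwise_disj_cons in D as [Db D]. destruct (IH D) as (h & S & C & O).
    exists h. repeat split; auto.
    + constructor; auto. intro x. apply O. intros c Hc.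
      rewrite Forall_forall in Db. auto with disj.
    + intros x Hx. apply O. intros c Hc. apply Hx. now right.
  - rewrite !pairwise_disj_cons in D. destruct D as (Dc & Db & _).
    rewrite Forall_forall in *. assert (Dcb : disj (n := n) c b) by (apply Dc; now left).
    exists (sw c b). repeat split.
    + now apply is_swap_product_sw.
    + constructor; [intro x; now apply sw_l|constructor; [intro x; now apply sw_r|]].
      apply carries_fixed. intros d x Hd. apply sw_out; auto. apply Dc. now right.
    + intros x Hx. apply sw_off; apply Hx; simpl; auto.
  - destruct (IH1 D) as (h1 & S1 & C1 & O1).
    destruct (IH2 (pairwise_disj_perm _ _ H1 D)) as (h2 & S2 & C2 & O2).
    exists (fun x => h2 (h1 x)). repeat split.
    + now apply is_swap_product_comp.
    + now apply carries_comp with l2.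
    + intros x Hx. rewrite O1 by auto. apply O2. intros b Hb. apply Hx.
      now apply Permutation_in with l2; [symmetry|].
Qed.

(** One halving is undone on each side and the parents are matched by induction. The children then
    match after [c] is retyped from direction [k] to [k']; permutations restore the given orders. *)
Lemma halving_carried m : forall l l', halving l -> halving l' -> length l = m -> length l' = m ->
  exists h, is_swap_product h /\ carries h l l'.
Proof.
  induction m as [|m IH]; intros l l' Hl Hl' E E'.
  { destruct l; [|discriminate]. destruct (halving_covers _ Hl origin) as (b & [] & _). }
  destruct (halving_cases _ Hl) as [->|(b & k & r & Hk & Hb & Hp)].
  { destruct (halving_cases _ Hl') as [->|(b & k & r & Hk & Hb & Hp)].
    - exists (fun x => x). split; [constructor|now apply carries_fixed].
    - apply Permutation_length in Hp. simpl in *. lia. }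
  destruct (halving_cases _ Hl') as [->|(c & k' & r' & Hk' & Hc & Hp')].
  { apply Permutation_length in Hp. simpl in *. lia. }
  pose proof (Permutation_length Hp). pose proof (Permutation_length Hp'). simpl in *.
  destruct (IH (b :: r) (c :: r')) as (h & S & C); simpl; auto; try lia.
  destruct (permutation_carried l _ (Permutation_sym Hp) (halving_disj _ Hl))
    as (h1 & S1 & C1 & _).
  destruct (permutation_carried _ _ Hp') as (h2 & S2 & C2 & _).
  { apply halving_disj. now constructor. }
  destruct (retyping k k' c Hk Hk') as (h3 & S3 & R3 & O3).
  exists (fun x => h2 (h3 (h (h1 x)))). split.
  { apply (is_swap_product_comp h2 (fun x => h3 (h (h1 x)))); auto.
    apply (is_swap_product_comp h3 (fun x => h (h1 x))); auto.
    now apply is_swap_product_comp. }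
  eapply (carries_comp h2 (fun x => h3 (h (h1 x)))); [|exact C2].
  eapply (carries_comp (fun x => h3 (h x)) h1); [exact C1|].
  inversion C as [|? ? ? ? Cb Cr]; subst.
  constructor; [|constructor].
  - intro x. now rewrite !phi_app, Cb, R3.
  - intro x. now rewrite !phi_app, Cb, R3.
  - eapply (carries_comp h3 h); [exact Cr|]. apply carries_fixed. intros d x Hd. apply O3.
    apply halving_disj in Hc. apply pairwise_disj_cons in Hc as [Hc _].
    rewrite Forall_forall in Hc. auto with disj.
Qed.

(** * Refinements of patterns and uniform grids *)

Lemma bapp_whole b : bapp b whole = b.
Proof. extensionality k. apply app_nil_r. Qed.

Lemma bapp_assoc b c d : bapp (bapp b c) d = bapp b (bapp c d).
Proof. extensionality k. unfold bapp. now rewrite app_assoc. Qed.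

Lemma halving_map b l r : halving (b :: l) -> halving r -> halving (map (bapp b) r ++ l).
Proof.
  intros Hb Hr. induction Hr as [|c r k Hk _ IH|r r' Hp _ IH]; simpl in *.
  - now rewrite bapp_whole.
  - rewrite <- !bapp_assoc. now constructor.
  - apply halving_perm with (map (bapp b) r ++ l); auto.
    apply Permutation_app_tail. now apply Permutation_map.
Qed.

Lemma halving_refine (V : brick -> list brick) l : halving l -> (forall b, In b l -> halving (V b)) ->
  halving (flat_map (fun b => map (bapp b) (V b)) l).
Proof.
  intros Hl HV.
  (* [r] holds bricks left alone for the moment: the head of the list waits there while the tail is
     refined. *)
  enough (G : forall r, halving (l ++ r) ->
    halving (flat_map (fun b => map (bapp b) (V b)) l ++ r)).
  { rewrite <- (app_nil_r (flat_map _ _)). apply G. now rewrite app_nil_r. }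
  clear Hl. induction l as [|b l IH]; intros r Hr; simpl; auto.
  rewrite <- app_assoc. apply halving_map; [|apply HV; now left].
  apply halving_perm with (flat_map (fun b => map (bapp b) (V b)) l ++ b :: r).
  - symmetry. apply Permutation_middle.
  - apply IH; [intros c Hc; apply HV; now right|].
    apply halving_perm with (b :: l ++ r); auto. apply Permutation_middle.
Qed.

(** Prescribing the words beyond [n] as well makes two bricks of one shape with a common point equal
    as functions. *)
Definition has_shape (m : nat -> nat) b : Prop :=
  (forall k, k < n -> length (b k) = m k) /\ (forall k, n <= k -> b k = []).

Lemma has_shape_eq m b c x y : has_shape m b -> has_shape m c -> phi b x = phi c y -> b = c.
Proof.
  intros [Hb Nb] [Hc Nc] E. destruct (phi_prefix b c x y E) as [v Hv].
  { intros k Hk. rewrite Hb, Hc; auto. }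
  extensionality k. destruct (lt_dec k n) as [Hk|Hk].
  - specialize (Hb k Hk). specialize (Hc k Hk). rewrite (Hv k Hk) in *.
    rewrite length_app in Hc. destruct (v k); [now rewrite app_nil_r|simpl in Hc; lia].
  - rewrite Nb, Nc; auto; lia.
Qed.

(** The grid is refined one coordinate at a time. That it is complete needs no counting: the listed
    brick that covers a point of a given brick of this shape must equal it. *)
Lemma halving_cells (m : nat -> nat) :
  exists l, halving l /\ forall b, In b l <-> has_shape m b.
Proof.
  assert (Line : forall k e, k < n -> exists l, halving l /\
    forall b, In b l -> forall i, length (b i) = if i =? k then e else 0).
  { intros k e Hk. induction e as [|e (l & Hl & Sl)].
    - exists [whole]. split; [constructor|]. intros b [<-|[]] i. simpl. now destruct (i =? k).
    - exists (flat_map (fun b => map (bapp b) [letter k false; letter k true]) l). split.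
      + apply halving_refine; auto. intros _ _. apply (halving_split whole []); auto. constructor.
      + intros b Hb i. apply in_flat_map in Hb as (c & Hc & Hb).
        specialize (Sl c Hc i). destruct Hb as [<-|[<-|[]]]; unfold bapp, letter;
          rewrite length_app, Sl; destruct (i =? k); simpl; lia. }
  assert (Cells : forall j, j <= n -> exists l, halving l /\
    forall b, In b l -> forall i, length (b i) = if i <? j then m i else 0).
  { induction j as [|j IH]; intro Hj.
    - exists [whole]. split; [constructor|]. now intros b [<-|[]] i.
    - destruct IH as (l & Hl & Sl); [lia|]. destruct (Line j (m j)) as (r & Hr & Sr); [lia|].
      exists (flat_map (fun b => map (bapp b) r) l). split.
      + apply halving_refine; auto.
      + intros b Hb i. apply in_flat_map in Hb as (c & Hc & Hb). apply in_map_iff in Hb as (v & <- & Hv).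
        unfold bapp. rewrite length_app, (Sl c Hc i), (Sr v Hv i).
        destruct (Nat.ltb_spec i j), (Nat.eqb_spec i j), (Nat.ltb_spec i (S j)); subst; lia. }
  destruct (Cells n (le_n n)) as (l & Hl & Sl).
  assert (Sh : forall b, In b l -> has_shape m b).
  { intros b Hb. split; intros k Hk; specialize (Sl b Hb k);
      destruct (Nat.ltb_spec k n); auto; try lia. now apply length_zero_iff_nil. }
  exists l. split; auto. intro b. split; auto. intro Hb.
  destruct (halving_covers l Hl (phi b origin)) as (c & Hc & [y E]).
  now rewrite (has_shape_eq m b c origin y) by auto.
Qed.

(** Bricks are functions and have no constructors to induct on; instead each occurs in the grid of
    its own shape, which arises by halvings. *)
Lemma brick_ind (Q : brick -> Prop) : Q whole ->
  (forall b k s, k < n -> Q b -> Q (bapp b (letter k s))) ->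
  forall b, (forall k, n <= k -> b k = []) -> Q b.
Proof.
  intros Q0 QS b Hb.
  assert (H : forall l, halving l -> forall c, In c l -> Q c).
  { induction 1 as [|d l k Hk _ IH|l l' Hp _ IH]; intros c Hc.
    - now destruct Hc as [<-|[]].
    - simpl in IH. destruct Hc as [<-|[<-|Hc]]; auto.
    - apply IH. now apply Permutation_in with l'; [symmetry|]. }
  destruct (halving_cells (fun k => length (b k))) as (l & Hl & Sl).
  apply (H l Hl), Sl. now split.
Qed.

Lemma pairwise_disj_NoDup l : pairwise_disj l -> NoDup l.
Proof.
  induction l as [|b l IH]; [constructor|]. rewrite pairwise_disj_cons. intros [Hb Hl].
  constructor; auto. intro H. rewrite Forall_forall in Hb. now apply Hb, disj_irrefl in H.
Qed.

Lemma carries_disj f l l' : (forall x y, f x = f y -> x = y) -> carries f l l' ->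
  pairwise_disj l -> pairwise_disj l'.
Proof.
  intros If C. induction C as [|b c l l' E C IH]; auto.
  rewrite !pairwise_disj_cons. intros [Hb Hl]. split; auto. clear IH Hl.
  induction C as [|b' c' l l' E' C IH]; constructor; apply Forall_cons_iff in Hb as [D Hb]; auto.
  intros x y H. rewrite <- E, <- E' in H. apply If in H. now apply (D x y).
Qed.

Lemma carries_In f l l' b : carries f l l' -> In b l ->
  exists c, In c l' /\ forall x, f (phi b x) = phi c x.
Proof.
  induction 1 as [|b' c' l l' E C IH]; intros []; subst; [exists c'; simpl; auto|].
  destruct IH as (c & Hc & E'); auto. exists c. simpl; auto.
Qed.

(** The images of the cells of depth [L] form a partition that need not arise by halving. Each cell
    is therefore subdivided until its image pieces have depth exactly [M]; these pieces fill the
    grid of depth [M], and two halving patterns can be compared. *)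
Theorem NV_is_swap_product f : NV f -> is_swap_product f.
Proof.
  intros ([L HL] & If & Sf). destruct (affine_bound f L HL) as [M HM].
  destruct (halving_cells (fun _ => L)) as (U & HU & SU).
  assert (Ch : forall b, exists p : brick * list brick, has_shape (fun _ => L) b ->
    (forall x, f (phi b x) = phi (fst p) x) /\ halving (snd p) /\
    forall v, In v (snd p) -> has_shape (fun _ => M) (bapp (fst p) v)).
  { intro b. destruct (classic (has_shape (fun _ => L) b)) as [Hb|Hb];
      [|exists (whole, []); contradiction].
    destruct (HM b) as (c & Ec & Lc); [apply Hb|].
    set (c' := fun k => if k <? n then c k else []).
    assert (Hc' : forall k, k < n -> c' k = c k).
    { intros k Hk. unfold c'. destruct (Nat.ltb_spec k n); auto; lia. }
    destruct (halving_cells (fun k => M - length (c k))) as (V & HV & SV).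
    exists (c', V). intros _. repeat split; auto; simpl.
    - intro x. rewrite Ec. symmetry. now apply phi_eqv.
    - intros k Hk. apply SV in H as [H _]. unfold bapp. rewrite length_app, H, Hc' by auto.
      specialize (Lc k Hk). lia.
    - intros k Hk. apply SV in H as [_ H]. unfold bapp. rewrite H by auto. unfold c'.
      destruct (Nat.ltb_spec k n); auto; lia. }
  apply choice in Ch as [F HF].
  set (B := flat_map (fun b => map (bapp b) (snd (F b))) U).
  set (C := flat_map (fun b => map (bapp (fst (F b))) (snd (F b))) U).
  assert (HB : halving B).
  { apply halving_refine; auto. intros b Hb. apply HF. now apply SU. }
  assert (HBC : carries f B C).
  { unfold B, C. assert (SU' : forall b, In b U -> has_shape (fun _ => L) b) by (intro; apply SU).
    clear HB B C SU HU. induction U as [|b U IH]; simpl; [constructor|].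
    apply Forall2_app.
    - destruct (HF b) as (E & _ & _); [apply SU'; now left|].
      generalize (snd (F b)). intro V. induction V as [|v V IHV]; constructor; auto.
      intro x. now rewrite !phi_app, E.
    - apply IH. intros c Hc. apply SU'. now right. }
  destruct (halving_cells (fun _ => M)) as (W & HW & SW).
  assert (SC : forall c, In c C -> has_shape (fun _ => M) c).
  { intros c Hc. apply in_flat_map in Hc as (b & Hb & Hc). apply in_map_iff in Hc as (v & <- & Hv).
    apply HF; auto. now apply SU. }
  assert (HC : halving C).
  { apply halving_perm with W; auto. apply NoDup_Permutation.
    - now apply pairwise_disj_NoDup, halving_disj.
    - apply pairwise_disj_NoDup, (carries_disj f B); auto. now apply halving_disj.
    (* By surjectivity a point of the grid cell [c] is hit from some brick of [B]; the image of that
       brick has the shape of [c] and meets it. *)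
    - intro c. split; [|intro Hc; apply SW; auto]. intro Hc. apply SW in Hc.
      destruct (Sf (phi c origin)) as [x Ex].
      destruct (halving_covers B HB x) as (b & Hb & [y ->]).
      destruct (carries_In f B C b HBC Hb) as (d & Hd & E). rewrite E in Ex.
      now rewrite <- (has_shape_eq (fun _ => M) d c y origin); auto. }
  destruct (halving_carried (length B) B C) as (h & Sh & Hh); auto.
  { symmetry. exact (Forall2_length HBC). }
  apply swap_products_ext with h; auto. intro x.
  destruct (halving_covers B HB x) as (b & Hb & [y ->]).
  clear - HBC Hh Hb. revert Hh Hb. induction HBC as [|b' c' B C E HBC IH]; [intros _ []|].
  intros Hh Hb. inversion Hh; subst. destruct Hb as [<-|Hb]; auto. congruence.
Qed.

End Generation.

(** * Patterns of rectangles *)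

Section Patterns.
Context {n : nat}.
Implicit Types (b c d p q v w z : brick) (x y : Cube n) (f g h : Cube n -> Cube n).

(** The values 0 and 1 beyond [n] are those of the full rectangle, which no halving alters; this
    makes [drect_box] an equality of pairs of functions. *)
Definition box b : rect :=
  (fun k => if k <? n then ev (b k) 0 else 0%R, fun k => if k <? n then ev (b k) 1 else 1%R).

Lemma ev_half (w : list bool) : (ev w (1 / 2) = (ev w 0 + ev w 1) / 2)%R.
Proof. rewrite (ev_affine w (1 / 2)), (ev_affine w 1). field. Qed.

Lemma box_low b k : k < n ->
  box (bapp b (letter k false)) =
  (fst (box b), upd (snd (box b)) k ((fst (box b) k + snd (box b) k) / 2)).
Proof.
  intro Hk. unfold box, upd, bapp, letter; simpl. f_equal; extensionality i.
  - destruct (Nat.ltb_spec i n); auto. destruct (Nat.eqb_spec i k) as [->|].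
    + rewrite ev_app. simpl. f_equal. field.
    + now rewrite app_nil_r.
  - destruct (Nat.eqb_spec i k) as [->|].
    + destruct (Nat.ltb_spec k n); [|lia]. rewrite ev_app, <- ev_half. simpl. f_equal. field.
    + now rewrite app_nil_r.
Qed.

Lemma box_high b k : k < n ->
  box (bapp b (letter k true)) =
  (upd (fst (box b)) k ((fst (box b) k + snd (box b) k) / 2), snd (box b)).
Proof.
  intro Hk. unfold box, upd, bapp, letter; simpl. f_equal; extensionality i.
  - destruct (Nat.eqb_spec i k) as [->|].
    + destruct (Nat.ltb_spec k n); [|lia]. rewrite ev_app, <- ev_half. simpl. f_equal. field.
    + now rewrite app_nil_r.
  - destruct (Nat.ltb_spec i n); auto. destruct (Nat.eqb_spec i k) as [->|].
    + rewrite ev_app. simpl. f_equal. field.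
    + now rewrite app_nil_r.
Qed.

Lemma box_whole : box whole = rect0.
Proof.
  unfold box, whole, rect0; simpl. f_equal; extensionality k; now destruct (k <? n).
Qed.

Lemma drect_box lo hi : drect n lo hi -> exists b, (lo, hi) = box b.
Proof.
  induction 1 as [|lo hi k Hk _ [b IH]|lo hi k Hk _ [b IH]].
  - exists whole. now rewrite box_whole.
  - exists (bapp b (letter k false)). now rewrite box_low, <- IH by auto.
  - exists (bapp b (letter k true)). now rewrite box_high, <- IH by auto.
Qed.

Lemma box_drect b : drect n (fst (box b)) (snd (box b)).
Proof.
  set (b' := fun k => if k <? n then b k else []).
  replace (box b) with (box b')
    by (unfold box, b'; f_equal; extensionality k; now destruct (k <? n)).
  apply (brick_ind (n := n) (fun c => drect n (fst (box c)) (snd (box c)))).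
  - rewrite box_whole. constructor.
  - intros c k [|] Hk IH; [rewrite box_high by auto|rewrite box_low by auto];
      cbn [fst snd]; now constructor.
  - intros k Hk. unfold b'. destruct (Nat.ltb_spec k n); auto; lia.
Qed.

Lemma in_box b x : in_rect (box b) x <-> covers b x.
Proof.
  unfold in_rect, box; simpl. split.
  - intro H. destruct (cube_of n (fun k => (pt x k - ev (b k) 0) / (/ 2) ^ length (b k))%R) as [y Hy].
    + intros k Hk. specialize (H k Hk). destruct (Nat.ltb_spec k n); [|lia].
      pose proof (half_pow_pos (length (b k))) as Hp.
      set (t := ((pt x k - ev (b k) 0) / (/ 2) ^ length (b k))%R).
      assert (E : ev (b k) t = pt x k) by (rewrite ev_affine; unfold t; field; lra).
      rewrite <- E, ev_le, ev_lt in H. exact H.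
    + exists y. apply cube_ext. intros k Hk. rewrite pt_phi, Hy, ev_affine by auto.
      pose proof (half_pow_pos (length (b k))). field. lra.
  - intros [y ->] k Hk. destruct (Nat.ltb_spec k n); [|lia].
    rewrite pt_phi, ev_le, ev_lt by auto. now apply pt_range.
Qed.

(** The left end must be attained, which gives $A=A'$. A smaller slope would miss the point $A'+B$,
    and a larger one would reach the excluded right end. *)
Lemma affine_onto (A B A' B' : R) : (0 < B -> 0 < B' ->
  (forall t, 0 <= t < 1 -> A' <= A + B * t < A' + B') ->
  (forall s, 0 <= s < 1 -> exists t, 0 <= t < 1 /\ A + B * t = A' + B' * s) ->
  A = A' /\ B = B')%R.
Proof.
  intros HB HB' H1 H2.
  assert (A = A') as <-.
  { destruct (H2 0%R) as (t & Ht & E); [lra|]. destruct (H1 0%R) as [H0 _]; [lra|].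
    assert (0 <= B * t)%R by (apply Rmult_le_pos; lra). lra. }
  split; auto. destruct (Rtotal_order B B') as [L|[L|L]]; auto; exfalso.
  - assert (Q : (B / B' < 1)%R) by (apply Rmult_lt_reg_r with B'; auto; field_simplify; lra).
    assert (0 < B / B')%R by (apply Rdiv_lt_0_compat; lra).
    destruct (H2 (B / B')%R) as (t & Ht & E); [lra|].
    replace (B' * (B / B'))%R with B in E by (field; lra).
    assert (B * t < B * 1)%R by (apply Rmult_lt_compat_l; lra). lra.
  - assert (Q : (B' / B < 1)%R) by (apply Rmult_lt_reg_r with B; auto; field_simplify; lra).
    assert (0 < B' / B)%R by (apply Rdiv_lt_0_compat; lra).
    destruct (H1 (B' / B)%R) as [_ H3]; [lra|].
    replace (B * (B' / B))%R with B' in H3 by (field; lra). lra.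
Qed.

(** The offsets and exponents allowed in [InNV] are arbitrary; mapping one box onto the other forces
    them, coordinate by coordinate, to be those of the charts. *)
Lemma affine_chart b c f (a : nat -> R) (j : nat -> Z) :
  (forall x, in_rect (box b) x -> in_rect (box c) (f x) /\
     forall k, k < n -> pt (f x) k = (a k + powerRZ 2 (j k) * pt x k)%R) ->
  (forall y, in_rect (box c) y -> exists x, in_rect (box b) x /\ f x = y) ->
  forall x, f (phi b x) = phi c x.
Proof.
  intros Hf Hs.
  assert (Hb : forall x, in_rect (box b) (phi b x)) by (intro; apply in_box, covers_phi).
  assert (Hc : forall x, in_rect (box c) (phi c x)) by (intro; apply in_box, covers_phi).
  assert (Coord : forall k t, k < n -> (0 <= t < 1)%R -> exists y : Cube n, pt y k = t).
  { intros k t Hk Ht. destruct (cube_of n (fun _ => t)) as [y Hy]; eauto. }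
  assert (Key : forall k, k < n ->
    (a k + powerRZ 2 (j k) * ev (b k) 0 = ev (c k) 0 /\
     powerRZ 2 (j k) * (/ 2) ^ length (b k) = (/ 2) ^ length (c k))%R).
  { intros k Hk. pose proof (half_pow_pos (length (b k))). pose proof (half_pow_pos (length (c k))).
    apply affine_onto; auto.
    - apply Rmult_lt_0_compat; auto. apply powerRZ_lt. lra.
    - intros t Ht. destruct (Coord k t Hk Ht) as [y Hy].
      destruct (Hf _ (Hb y)) as [R E]. specialize (R k Hk). simpl in R.
      destruct (Nat.ltb_spec k n); [|lia].
      rewrite (E k Hk), pt_phi, Hy, (ev_affine (b k) t), (ev_affine (c k) 1) in R by auto. lra.
    - intros s Hsr. destruct (Coord k s Hk Hsr) as [y Hy].
      destruct (Hs _ (Hc y)) as (x & Rx & E). pose proof Rx as Rx'.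
      apply in_box in Rx as [x' ->]. exists (pt x' k). split; [now apply pt_range|].
      destruct (Hf _ Rx') as [_ Ek]. specialize (Ek k Hk).
      rewrite E, !pt_phi, Hy, (ev_affine (c k)), (ev_affine (b k)) in Ek by auto. lra. }
  intro x. apply cube_ext. intros k Hk. destruct (Hf _ (Hb x)) as [_ E].
  destruct (Key k Hk) as [K1 K2].
  rewrite (E k Hk), !pt_phi, (ev_affine (b k)), (ev_affine (c k)), <- K1, <- K2 by auto. ring.
Qed.

Lemma rects_boxes P : Forall (fun r => drect n (fst r) (snd r)) P -> exists l, P = map box l.
Proof.
  induction 1 as [|[lo hi] P H _ [l ->]]; [now exists []|].
  destruct (drect_box _ _ H) as [b E]. exists (b :: l). simpl. now rewrite <- E.
Qed.

Lemma nth_map {A B} (F : A -> B) l i (s : A) (t : B) :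
  i < length l -> nth i (map F l) t = F (nth i l s).
Proof.
  intro H. rewrite <- (map_nth F). apply nth_indep. now rewrite length_map.
Qed.

Lemma bricks_bound (l : list brick) : exists M, forall b, In b l -> forall k, k < n -> length (b k) <= M.
Proof.
  induction l as [|b l [M HM]]; [exists 0; intros b []|].
  destruct (brick_bound n b) as [M' HM']. exists (M + M').
  intros c [<-|Hc] k Hk; [specialize (HM' k Hk)|specialize (HM c Hc k Hk)]; lia.
Qed.

Lemma InNV_NV f : InNV n f -> NV f.
Proof.
  intros (P & Q & (DP & IP & CP) & (DQ & IQ & CQ) & L & Hf).
  destruct (rects_boxes P DP) as [B ->]. destruct (rects_boxes Q DQ) as [C ->].
  rewrite !length_map in *.
  assert (E : forall i, i < length B -> forall x, f (phi (nth i B whole) x) = phi (nth i C whole) x).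
  { intros i Hi. destruct (Hf i Hi) as (a & j & H1 & H2).
    rewrite !(nth_map box _ _ whole) in H1, H2 by congruence.
    now apply affine_chart with a j. }
  assert (CB : forall x, exists i y, i < length B /\ x = phi (nth i B whole) y).
  { intro x. destruct (CP x) as (i & Hi & Hx). rewrite (nth_map box _ _ whole), in_box in Hx by auto.
    destruct Hx as [y ->]. eauto. }
  repeat split.
  (* A brick at least as deep as all bricks of the pattern lies in the one that contains its lower
     corner. *)
  - destruct (bricks_bound B) as [M HM]. exists M. intros b Hb.
    destruct (CB (phi b origin)) as (i & y & Hi & Ey). symmetry in Ey.
    destruct (phi_sub _ _ _ _ Ey) as [v Hv].
    + intros k Hk. specialize (Hb k Hk). specialize (HM (nth i B whole) (nth_In _ _ Hi) k Hk). lia.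
    + exists (bapp (nth i C whole) v). intro x. now rewrite Hv, E, phi_app.
  - intros x y Exy. destruct (CB x) as (i & x' & Hi & ->), (CB y) as (j & y' & Hj & ->).
    rewrite !E in Exy by auto. destruct (Nat.eq_dec i j) as [<-|Ne].
    + now apply phi_inj in Exy as <-.
    + destruct (IQ i j) with (phi (nth i C whole) x'); try lia.
      rewrite !(nth_map box _ _ whole), !in_box by lia. rewrite Exy at 2. split; apply covers_phi.
  - intro y. destruct (CQ y) as (i & Hi & Hy). rewrite <- L in Hi.
    destruct (Hf i Hi) as (a & j & _ & H2). destruct (H2 y Hy) as (x & _ & <-). eauto.
Qed.

Lemma pattern_boxes l : pairwise_disj (n := n) l -> (forall x, exists b, In b l /\ covers b x) ->
  is_pattern n (map box l).
Proof.
  intros D C. repeat split.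
  - apply Forall_map, Forall_forall. intros b _. apply box_drect.
  - rewrite length_map. intros i j Hi Hj Ne x.
    rewrite !(nth_map box _ _ whole), !in_box by auto. intros [Ci Cj].
    destruct (ForallOrdPairs_In D _ _ (nth_In _ whole Hi) (nth_In _ whole Hj)) as [E|[E|E]].
    + apply Ne. eapply NoDup_nth; eauto. now apply (pairwise_disj_NoDup (n := n)).
    + now apply (disj_covers _ _ x E).
    + now apply (disj_covers _ _ x E).
  - intro x. destruct (C x) as (b & Hb & Cb). destruct (In_nth _ _ whole Hb) as (i & Hi & <-).
    exists i. rewrite length_map, (nth_map box _ _ whole), in_box by auto. auto.
Qed.

Lemma NV_InNV f : NV f -> InNV n f.
Proof.
  intros ([L HL] & If & Sf). destruct (halving_cells (n := n) (fun _ => L)) as (U & HU & SU).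
  assert (Ch : forall b, exists c, has_shape (n := n) (fun _ => L) b -> forall x, f (phi b x) = phi c x).
  { intro b. destruct (classic (has_shape (n := n) (fun _ => L) b)) as [Hb|Hb];
      [|exists whole; contradiction].
    destruct (HL b) as [c Hc]; [|eauto]. intros k Hk. now rewrite (proj1 Hb). }
  apply choice in Ch as [F HF].
  assert (HC : carries f U (map F U)).
  { assert (SU' : forall b, In b U -> has_shape (n := n) (fun _ => L) b) by (intro; apply SU).
    clear SU HU. induction U as [|b U IH]; constructor.
    - apply HF, SU'. now left.
    - apply IH. intros c Hc. apply SU'. now right. }
  exists (map box U), (map box (map F U)). split; [|split; [|split]].
  - apply pattern_boxes; [now apply halving_disj|now apply halving_covers].
  - apply pattern_boxes.
    + apply (carries_disj f U); auto. now apply halving_disj.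
    + intro y. destruct (Sf y) as [x <-]. destruct (halving_covers U HU x) as (b & Hb & [z ->]).
      exists (F b). split; [now apply in_map|]. rewrite HF by now apply SU. apply covers_phi.
  - now rewrite !length_map.
  - rewrite length_map. intros i Hi. rewrite !(nth_map box _ _ whole), (nth_map F _ _ whole)
      by (rewrite ?length_map; auto).
    assert (Hb : In (nth i U whole) U) by now apply nth_In. apply SU in Hb.
    revert Hb. generalize (nth i U whole). intros b Hb. specialize (HF b Hb).
    set (c := F b) in *.
    (* The slope is the ratio of the side lengths of [c] and [b]; the offset sends lower corner to
       lower corner. *)
    exists (fun k => (ev (c k) 0 - powerRZ 2 (Z.of_nat (length (b k)) - Z.of_nat (length (c k)))
                                   * ev (b k) 0)%R),
      (fun k => (Z.of_nat (length (b k)) - Z.of_nat (length (c k)))%Z).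
    split.
    + intros x Hx. apply in_box in Hx as [y ->]. rewrite HF. split; [apply in_box, covers_phi|].
      intros k Hk. rewrite !pt_phi, (ev_affine (c k) (pt y k)), (ev_affine (b k) (pt y k)) by auto.
      enough (E : (powerRZ 2 (Z.of_nat (length (b k)) - Z.of_nat (length (c k))) *
        (/ 2) ^ length (b k) = (/ 2) ^ length (c k))%R) by (rewrite <- E; ring).
      unfold Z.sub. rewrite powerRZ_add, powerRZ_neg', <- !pow_powerRZ, !pow_inv by lra.
      field. split; apply pow_nonzero; lra.
    + intros y Hy. apply in_box in Hy as [x ->]. exists (phi b x).
      split; [apply in_box, covers_phi|apply HF].
Qed.

End Patterns.

(** * Convex sets in trees *)

Section Trees.
Context {V : Type} (adj : V -> V -> Prop).

Lemma is_walk_app l a m :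
  is_walk adj (l ++ a :: m) <-> is_walk adj (l ++ [a]) /\ is_walk adj (a :: m).
Proof.
  induction l as [|b l IH]; [simpl; tauto|].
  destruct l as [|c l]; [simpl; tauto|].
  change ((b :: c :: l) ++ a :: m) with (b :: (c :: l) ++ a :: m).
  change ((b :: c :: l) ++ [a]) with (b :: (c :: l) ++ [a]). simpl in *. tauto.
Qed.

Lemma no_backtrack_app (l : list V) a b m :
  no_backtrack (l ++ a :: b :: m) <-> no_backtrack (l ++ [a; b]) /\ no_backtrack (a :: b :: m).
Proof.
  induction l as [|c l IH]; [simpl; destruct m; tauto|].
  destruct l as [|d [|e l]]; simpl in *; destruct m; tauto.
Qed.

Lemma no_backtrack_turn (l : list V) x a y m : no_backtrack (l ++ [x; a]) ->
  no_backtrack (a :: y :: m) -> x <> y -> no_backtrack (l ++ x :: a :: y :: m).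
Proof. intros H1 H2 H3. apply no_backtrack_app. split; simpl in *; auto. Qed.

Lemma no_backtrack_tail (l m : list V) : no_backtrack (l ++ m) -> no_backtrack m.
Proof.
  intro H. destruct m as [|a [|b m]]; simpl; auto. now apply no_backtrack_app in H.
Qed.

Lemma is_walk_tail l m : is_walk adj (l ++ m) -> is_walk adj m.
Proof. intro H. destruct m as [|a m]; simpl; auto. now apply is_walk_app in H. Qed.

Lemma no_backtrack_rev (l : list V) : no_backtrack l -> no_backtrack (rev l).
Proof.
  induction l as [|a [|b [|c l]] IH]; simpl; auto. intros [Ne H].
  apply IH in H. simpl in H. rewrite <- app_assoc in H. rewrite <- !app_assoc.
  apply no_backtrack_turn; simpl; auto.
Qed.

Lemma last_shift (a d : V) l : last (a :: l) d = last l a.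
Proof.
  destruct l as [|b l] using rev_ind; [reflexivity|]. now rewrite app_comm_cons, !last_last.
Qed.

Lemma hd_rev (u : V) p : hd_error (rev (u :: p)) = Some (last p u).
Proof.
  destruct p as [|v p] using rev_ind; [reflexivity|].
  rewrite last_last, app_comm_cons, rev_app_distr. reflexivity.
Qed.

(** All vertices of a path without backtracking, both ends included. Stating the ends by [hd_error]
    makes reversal symmetric and rules out the empty list. *)
Definition reduced u v l : Prop :=
  is_walk adj l /\ no_backtrack l /\ hd_error l = Some u /\ hd_error (rev l) = Some v.

Lemma reduced_tail u v l a m : reduced u v (l ++ a :: m) -> reduced a v (a :: m).
Proof.
  intros (W & N & _ & E). repeat split.
  - now apply is_walk_tail in W.
  - now apply no_backtrack_tail in N.
  - rewrite rev_app_distr in E. simpl in *. now destruct (rev m).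
Qed.

Lemma reduced_cons u v l : reduced u v l -> exists p, l = u :: p.
Proof. intros (_ & _ & H & _). destruct l; inversion H; eauto. Qed.

Definition automorphism (s : V -> V) : Prop :=
  (forall u v, s u = s v -> u = v) /\ (forall u v, adj u v -> adj (s u) (s v)).

Lemma reduced_map s u v l : automorphism s -> reduced u v l -> reduced (s u) (s v) (map s l).
Proof.
  intros [I A] (W & N & H & H'). repeat split.
  - clear - W A. induction l as [|a [|b l] IH]; try exact Logic.I.
    destruct W as [Ab W]. split; [exact (A _ _ Ab)|exact (IH W)].
  - clear - N I. induction l as [|a [|b [|c l]] IH]; try exact Logic.I.
    destruct N as [Ne N]. split; [intro E; now apply Ne, I|exact (IH N)].
  - destruct l; inversion H; reflexivity.
  - rewrite <- map_rev. destruct (rev l); inversion H'; reflexivity.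
Qed.

(** In a tree these are the vertex sets of subtrees, the empty set included. *)
Definition convex (C : V -> Prop) : Prop :=
  forall u v l, C u -> C v -> reduced u v l -> Forall C l.

Lemma convex_and C D : convex C -> convex D -> convex (fun v => C v /\ D v).
Proof.
  intros HC HD u v l [Cu Du] [Cv Dv] R. apply Forall_and; [exact (HC u v l Cu Cv R)|exact (HD u v l Du Dv R)].
Qed.

(** The nearest-point projection of [d] to [C], for convex [C], seen as the place where the path to
    [d] leaves [C] for good. The form [y :: m] forces [d] to lie outside [C]. *)
Definition gate (C : V -> Prop) d a : Prop :=
  C a /\ exists y m, reduced a d (a :: y :: m) /\ Forall (fun v => ~ C v) (y :: m).

Context (T : is_tree adj).

Lemma adj_sym u v : adj u v -> adj v u.
Proof. apply T. Qed.

Lemma is_walk_rev l : is_walk adj l -> is_walk adj (rev l).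
Proof.
  induction l as [|a [|b l] IH]; simpl; auto. intros [H W].
  rewrite <- app_assoc. apply is_walk_app. split; simpl in *; auto using adj_sym.
Qed.

Lemma reduced_rev u v l : reduced u v l -> reduced v u (rev l).
Proof.
  intros (W & N & H & H'). repeat split; auto using is_walk_rev, no_backtrack_rev.
  now rewrite rev_involutive.
Qed.

Lemma reduced_closed v a b l : ~ reduced v v (a :: b :: l).
Proof.
  intros (W & N & H & H'). rewrite hd_rev in H'. inversion H; subst a.
  destruct T as (_ & _ & _ & _ & Tc). apply (Tc v (b :: l)); auto; [discriminate|congruence].
Qed.

(** A step put in front of a reduced path either leaves it reduced or cancels against the next
    step. *)
Lemma reduced_exists u v : exists l, reduced u v l.
Proof.
  destruct T as (_ & _ & _ & Conn & _). destruct (Conn u v) as (p & W & E).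
  revert u W E. induction p as [|w p IH]; intros u W E.
  - simpl in E. subst v. exists [u]. repeat split.
  - destruct W as [A W].
    destruct (IH w W) as (l & R).
    { now rewrite <- E, last_shift. }
    destruct (reduced_cons _ _ _ R) as [q ->]. destruct q as [|y q].
    + exists [u; w]. destruct R as (_ & _ & _ & R). simpl in R. repeat split; auto.
    + destruct (classic (u = y)) as [<-|Ne].
      * exists (u :: q). now apply (reduced_tail w v [w]).
      * destruct R as (RW & RN & _ & RE). exists (u :: w :: y :: q).
        split; [split; auto|split; [split; auto|split; auto]].
        rewrite hd_rev, !last_shift in *. exact RE.
Qed.

(** Where two paths part, the reverse of one followed by the other would be a closed reduced
    path. *)
Lemma reduced_unique l : forall u v m, reduced u v l -> reduced u v m -> l = m.
Proof.
  induction l as [|x p IH]; intros u v m Rl Rm; [destruct Rl as (_ & _ & H & _); discriminate|].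
  assert (x = u) as -> by (destruct Rl as (_ & _ & H & _); now inversion H).
  destruct (reduced_cons _ _ _ Rm) as [q ->].
  destruct p as [|a p], q as [|b q]; auto.
  - assert (u = v) as <- by (destruct Rl as (_ & _ & _ & H); now inversion H).
    now apply reduced_closed in Rm.
  - assert (u = v) as <- by (destruct Rm as (_ & _ & _ & H); now inversion H).
    now apply reduced_closed in Rl.
  - destruct (classic (a = b)) as [<-|Ne].
    + f_equal. apply IH with a v; [now apply (reduced_tail u v [u])|now apply (reduced_tail u v [u])].
    + exfalso. apply reduced_rev in Rl. destruct Rl as (W1 & N1 & H1 & E1), Rm as (W2 & N2 & H2 & E2).
      simpl in W1, N1, H1. rewrite <- app_assoc in W1, N1, H1. simpl in W1, N1, H1.
      assert (R : reduced v v (rev p ++ a :: u :: b :: q)).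
      { repeat split.
        - change (rev p ++ a :: u :: b :: q) with (rev p ++ [a] ++ u :: b :: q).
          rewrite app_assoc. apply is_walk_app. split; auto. now rewrite <- app_assoc.
        - now apply no_backtrack_turn.
        - now destruct (rev p).
        - rewrite rev_app_distr. change (a :: u :: b :: q) with ([a] ++ u :: b :: q).
          rewrite rev_app_distr. simpl in *. now destruct (rev q). }
      destruct (rev p) as [|c [|d r]]; simpl in R; now apply reduced_closed in R.
Qed.

Lemma reduced_join u a v l x y m : reduced u a (l ++ [x; a]) -> reduced a v (a :: y :: m) ->
  x <> y -> reduced u v (l ++ x :: a :: y :: m).
Proof.
  intros (W1 & N1 & H1 & _) (W2 & N2 & _ & E2) Ne. repeat split.
  - change (l ++ x :: a :: y :: m) with (l ++ [x] ++ a :: y :: m).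
    rewrite app_assoc. apply is_walk_app. split; auto. now rewrite <- app_assoc.
  - now apply no_backtrack_turn.
  - now destruct l.
  - rewrite rev_app_distr. change (x :: a :: y :: m) with ([x] ++ a :: y :: m).
    rewrite rev_app_distr. destruct (rev (a :: y :: m)); [discriminate|auto].
Qed.

(** The image of the path between two fixed vertices is reduced with the same ends, so by uniqueness
    it is the same path, vertex by vertex. *)
Lemma fixed_convex s : automorphism s -> convex (fun v => s v = v).
Proof.
  intros As u v l Eu Ev R. pose proof (reduced_map s _ _ _ As R) as R'.
  rewrite Eu, Ev in R'. pose proof (reduced_unique _ _ _ _ R' R) as E. clear - E.
  induction l as [|a l IH]; constructor; injection E as E1 E2; auto.
Qed.

(** [s] reverses the path from [v] to [s v]. With an odd number of vertices the middle one is fixed;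
    with an even number the middle edge would be inverted. *)
Lemma involution_fixed s : automorphism s -> (forall v, s (s v) = v) ->
  (forall u v, adj u v -> ~ (s u = v /\ s v = u)) -> exists v, s v = v.
Proof.
  intros As Inv NoInv. assert (Inh : inhabited V) by apply T. destruct Inh as [v].
  destruct (reduced_exists v (s v)) as [l R].
  pose proof (reduced_rev _ _ _ (reduced_map s _ _ _ As R)) as R'. rewrite Inv in R'.
  pose proof (reduced_unique _ _ _ _ R' R) as E.
  assert (Hn : forall i, i < length l -> s (nth (length l - S i) l v) = nth i l v).
  { intros i Hi. transitivity (nth i (rev (map s l)) v); [|now rewrite E].
    rewrite rev_nth by now rewrite length_map.
    rewrite length_map, (nth_indep (map s l) v (s v)) by (rewrite length_map; lia).
    now rewrite map_nth. }
  assert (Lpos : 0 < length l) by (destruct (reduced_cons _ _ _ R) as [p ->]; simpl; lia).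
  destruct (Nat.Even_or_Odd (length l)) as [[k Hk]|[k Hk]].
  - exfalso. apply (NoInv (nth (k - 1) l v) (nth k l v)).
    + destruct R as (W & _). clear - W Hk Lpos.
      assert (G : forall i l, is_walk adj l -> S i < length l -> adj (nth i l v) (nth (S i) l v)).
      { clear. induction i as [|i IH]; intros [|a [|b l]] W Hl; simpl in *; try lia; [apply W|].
        apply (IH (b :: l)); simpl; try lia. apply W. }
      replace k with (S (k - 1)) at 2 by lia. apply G; auto. lia.
    + split.
      * rewrite <- (Hn k) by lia. do 2 f_equal. lia.
      * rewrite <- (Hn (k - 1)) by lia. do 2 f_equal. lia.
  - exists (nth k l v). rewrite <- (Hn k) at 2 by lia. do 2 f_equal. lia.
Qed.

(** The gate is the last vertex of [C] on the path from [c] to [d]. *)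
Lemma gate_exists (C : V -> Prop) c d : C c -> ~ C d -> exists a, gate C d a.
Proof.
  intros Cc Nd. destruct (reduced_exists c d) as [l R].
  assert (G : forall l c, C c -> exists a p q, c :: l = p ++ a :: q /\ C a /\
    Forall (fun v => ~ C v) q).
  { clear. induction l as [|x l IH]; intros c Cc.
    - exists c, [], []. auto.
    - destruct (classic (exists e, In e (x :: l) /\ C e)) as [(e & He & Ce)|N].
      + destruct (classic (C x)) as [Cx|Nx].
        * destruct (IH x Cx) as (a & p & q & E & Ca & F). exists a, (c :: p), q.
          now rewrite E.
        * destruct (IH c Cc) as (a & p & q & E & Ca & F). destruct p as [|c' p].
          -- inversion E; subst. destruct He as [<-|He]; [contradiction|].
             rewrite Forall_forall in F. now destruct (F e He).
          -- inversion E; subst. exists a, (c' :: x :: p), q. auto.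
      + exists c, [], (x :: l). repeat split; auto. apply Forall_forall. intros e He Ce. eauto. }
  destruct (reduced_cons _ _ _ R) as [r ->].
  destruct (G r c Cc) as (a & p & q & E & Ca & F). rewrite E in R. apply reduced_tail in R.
  exists a. split; auto. destruct q as [|y q]; [|eauto].
  destruct R as (_ & _ & _ & R). inversion R. subst. contradiction.
Qed.

(** Up to the gate the path stays in [C] by convexity, afterwards outside, so the two pieces join
    without backtracking. A second vertex in [C] prevents [c] from being a gate itself, and passing
    through [a] is what the Helly argument needs. *)
Lemma gate_path (C : V -> Prop) c d a : convex C -> gate C d a -> C c -> c = a \/
  exists z l, reduced c d (c :: z :: l) /\ C z /\ In a (z :: l).
Proof.
  intros HC (Ca & y & m & R & F) Cc. destruct (reduced_exists c a) as [l Rl].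
  pose proof (HC _ _ _ Cc Ca Rl) as Fl. destruct (reduced_cons _ _ _ Rl) as [p ->].
  destruct p as [|x p _] using rev_ind.
  { left. destruct Rl as (_ & _ & _ & E). now inversion E. }
  right. assert (x = a) as ->.
  { destruct Rl as (_ & _ & _ & E). rewrite app_comm_cons, rev_app_distr in E. now inversion E. }
  inversion F as [|? ? Ny Fm]; subst.
  destruct p as [|x p _] using rev_ind.
  - simpl in *. exists a, (y :: m). split; [|split; simpl; auto].
    apply (reduced_join c a d [] c y m); auto. intros <-. contradiction.
  - assert (Cx : C x).
    { rewrite Forall_forall in Fl. apply Fl. right. rewrite <- app_assoc.
      apply in_or_app. simpl; auto. }
    assert (Rj : reduced c d ((c :: p) ++ x :: a :: y :: m)).
    { apply reduced_join; auto.
      - rewrite <- app_assoc in Rl. exact Rl.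
      - intros <-. contradiction. }
    destruct p as [|z p].
    + exists x, (a :: y :: m). split; [exact Rj|]. simpl; auto.
    + exists z, (p ++ x :: a :: y :: m). split; [exact Rj|]. split.
      * rewrite Forall_forall in Fl. apply Fl. right. simpl. auto.
      * right. apply in_or_app. simpl; auto.
Qed.

Lemma gate_unique (C : V -> Prop) d a a' : convex C -> gate C d a -> gate C d a' -> a = a'.
Proof.
  intros HC Ga Ga'. destruct (gate_path C a' d a HC Ga) as [E|(z & l & R & Cz & _)]; auto.
  { apply Ga'. }
  destruct Ga' as (_ & y & m & R' & F). pose proof (reduced_unique _ _ _ _ R R') as E.
  inversion E; subst. inversion F; subst. contradiction.
Qed.

(** The path from the gate to [d] is cut short if it came through [d'] and extended by [d']
    otherwise; either way it starts at the same gate. *)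
Lemma gate_step (C : V -> Prop) d d' a : gate C d a -> ~ C d' -> adj d d' -> gate C d' a.
Proof.
  intros (Ca & y & m & R & F) Nd A. split; auto.
  destruct (y :: m) as [|e p _] eqn:Ep using rev_ind; [discriminate|].
  assert (e = d) as ->.
  { destruct R as (_ & _ & _ & E). rewrite app_comm_cons, rev_app_distr in E. now inversion E. }
  destruct (classic (exists q, a :: p = q ++ [d'])) as [[q Eq]|Ne].
  - assert (Fp := F). apply Forall_app in Fp as [Fp _].
    destruct p as [|x p]; [destruct q as [|? [|]]; inversion Eq; subst; contradiction|].
    exists x, p. split; auto. rewrite app_comm_cons in R. destruct R as (W & N & H & _).
    rewrite Eq in W, N. split; [|split; [|split; auto]]; rewrite Eq.
    + rewrite <- app_assoc in W. now apply is_walk_app in W.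
    + apply no_backtrack_rev in N. rewrite rev_app_distr in N.
      rewrite <- (rev_involutive (q ++ [d'])). apply no_backtrack_rev.
      exact (no_backtrack_tail [d] _ N).
    + rewrite rev_app_distr. reflexivity.
  - assert (Rj : reduced a d' ((a :: p) ++ [d; d'])).
    { destruct R as (W & N & H & _). rewrite app_comm_cons in W, N. repeat split.
      - apply (is_walk_app (a :: p) d [d']). split; auto. simpl. auto.
      - destruct (a :: p) as [|x q _] eqn:Eq using rev_ind; [discriminate|].
        rewrite <- app_assoc in *. simpl in *. apply no_backtrack_turn; simpl; auto.
        intros ->. apply Ne. now exists q.
      - change [d; d'] with ([d] ++ [d']). rewrite app_assoc, rev_app_distr. reflexivity. }
    assert (F' : Forall (fun v => ~ C v) (p ++ [d; d'])).
    { apply Forall_app in F as [Fp Fd]. apply Forall_app. split; auto.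
      inversion Fd; subst. auto. }
    destruct p as [|x p]; [exists d, [d']; auto|exists x, (p ++ [d; d']); auto].
Qed.

Lemma gate_constant (C D : V -> Prop) d d' a : convex D -> (forall v, D v -> ~ C v) ->
  D d -> D d' -> gate C d a -> gate C d' a.
Proof.
  intros HD Dj Dd Dd' G. destruct (reduced_exists d d') as [l R].
  pose proof (HD _ _ _ Dd Dd' R) as F. destruct (reduced_cons _ _ _ R) as [p ->].
  destruct R as (W & _ & _ & E). rewrite hd_rev in E. inversion E as [E']. clear E.
  revert d W F G E' Dd. induction p as [|x p IH]; intros d W F G E' Dd; [now simpl in E'; subst|].
  inversion F as [|? ? _ F']; subst. inversion F'; subst. destruct W as [A W].
  rewrite last_shift in *. apply (IH x); auto. apply gate_step with d; auto.
Qed.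

Lemma gate_map (C : V -> Prop) s d a : automorphism s -> (forall v, C v <-> C (s v)) ->
  gate C d a -> gate C (s d) (s a).
Proof.
  intros As HC (Ca & y & m & R & F). split; [exact (proj1 (HC a) Ca)|].
  exists (s y), (map s m). split; [exact (reduced_map s _ _ _ As R)|].
  change (s y :: map s m) with (map s (y :: m)). apply Forall_map.
  eapply Forall_impl; [|exact F]. intros v Nv Cv. exact (Nv (proj2 (HC v) Cv)).
Qed.

(** All of [D] is seen from [C] through one gate, and [s] carries the gate for [d] to the gate for
    [s d], again a vertex of [D]. *)
Lemma automorphism_fixes_gate (C D : V -> Prop) s d a : convex C -> convex D ->
  (forall v, D v -> ~ C v) -> D d -> gate C d a -> automorphism s ->
  (forall v, C v <-> C (s v)) -> (forall v, D v <-> D (s v)) -> s a = a.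
Proof.
  intros HC HD Dj Dd G As Cs Ds. apply gate_unique with C (s d); auto.
  - now apply gate_map.
  - apply gate_constant with D d; auto. exact (proj1 (Ds d) Dd).
Qed.

(** If [d] in $B\cap C$ lies outside [A], the paths to [d] from $A\cap B$ and from $A\cap C$ both
    pass through the gate of [A] towards [d], which therefore lies in [B] and in [C]. *)
Lemma helly3 (A B C : V -> Prop) : convex A -> convex B -> convex C ->
  (exists v, A v /\ B v) -> (exists v, A v /\ C v) -> (exists v, B v /\ C v) ->
  exists v, A v /\ B v /\ C v.
Proof.
  intros HA HB HC (b & Ab & Bb) (c & Ac & Cc) (d & Bd & Cd).
  destruct (classic (A d)) as [Ad|Nd]; [eauto|].
  destruct (gate_exists A b d Ab Nd) as [a Ga].
  assert (K : forall E e, convex E -> A e -> E e -> E d -> E a).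
  { intros E e HE Ae Ee Ed. destruct (gate_path A e d a HA Ga Ae) as [<-|(z & l & R & _ & I)]; auto.
    pose proof (HE _ _ _ Ee Ed R) as F. rewrite Forall_forall in F. apply F. now right. }
  exists a. split; [apply Ga|]. split; [now apply (K B b)|now apply (K C c)].
Qed.

Lemma helly (L : list (V -> Prop)) : (forall C, In C L -> convex C) ->
  (forall C D, In C L -> In D L -> exists v, C v /\ D v) ->
  exists v, forall C, In C L -> C v.
Proof.
  remember (length L) as m eqn:Em. revert L Em. induction m as [|m IH]; intros L Em HC HL.
  - assert (Inh : inhabited V) by apply T. destruct Inh as [v]. exists v.
    destruct L; [intros C []|discriminate].
  - destruct L as [|A L]; [discriminate|]. destruct L as [|B L].
    + destruct (HL A A) as (v & Av & _); simpl; auto. exists v. now intros C [<-|[]].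
    (* Intersecting the other sets with [A] shortens the list by one; that the intersections still
       meet pairwise is the case of three sets. *)
    + destruct (IH (map (fun C v => A v /\ C v) (B :: L))) as (v & Hv).
      * rewrite length_map. simpl in *. lia.
      * intros C HI. apply in_map_iff in HI as (C' & <- & HI). apply convex_and; apply HC; simpl in *; auto.
      * intros C D HI HJ. apply in_map_iff in HI as (C' & <- & HI). apply in_map_iff in HJ as (D' & <- & HJ).
        destruct (helly3 A C' D') as (v & ? & ? & ?); simpl in *; auto.
        exists v. auto.
      * exists v. intros C [<-|HI].
        -- destruct (Hv (fun v => A v /\ B v)); [now left|auto].
        -- destruct (Hv (fun v => A v /\ C v)); auto.
           apply in_map_iff. eauto.
Qed.

End Trees.

(** * Finitely many swaps generate *)

Definition strip (w : list bool) : brick := fun k => if k =? 0 then w else [].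

Fixpoint words (m : nat) : list (list bool) :=
  match m with
  | 0 => [[]]
  | S m' => map (cons false) (words m') ++ map (cons true) (words m')
  end.

Lemma in_words m : forall w, In w (words m) <-> length w = m.
Proof.
  induction m as [|m IH]; intro w; simpl.
  - split; [now intros [<-|[]]|]. intro H. left. symmetry. now apply length_zero_iff_nil.
  - rewrite in_app_iff, !in_map_iff. split.
    + intros [(v & <- & H)|(v & <- & H)]; apply IH in H; simpl; lia.
    + destruct w as [|s w]; [discriminate|]. intro H. injection H as H. apply IH in H.
      destruct s; [right|left]; eauto.
Qed.

Lemma third_word (s w : list bool) : exists v, length v = 3 /\ v <> s /\ v <> w.
Proof.
  assert (D : forall u, (u <> s /\ u <> w) \/ u = s \/ u = w).
  { intro u. destruct (list_eq_dec bool_dec u s), (list_eq_dec bool_dec u w); auto. }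
  destruct (D [true; true; true]) as [H1|H1]; [exists [true; true; true]; auto|].
  destruct (D [true; true; false]) as [H2|H2]; [exists [true; true; false]; auto|].
  exists [true; false; false]. repeat split; destruct H1, H2; congruence.
Qed.

(** For mask and word of length three this is translation in $(\mathbb Z/2)^3$: each pair of words
    rules out only one mask, their difference. *)
Fixpoint xor_word (m w : list bool) : list bool :=
  match m, w with
  | s :: m', t :: w' => xorb s t :: xor_word m' w'
  | _, _ => w
  end.

Lemma length_xor_word m : forall w, length (xor_word m w) = length w.
Proof. induction m as [|s m IH]; intros [|t w]; simpl; auto. Qed.

Lemma xor_word_inj m : forall v w, xor_word m v = xor_word m w -> v = w.
Proof.
  induction m as [|s m IH]; intros [|t v] [|u w] E; simpl in *; try congruence.
  injection E as E1 E2. apply IH in E2 as <-. f_equal. now destruct s, t, u.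
Qed.

(* Four words have at most six pairwise differences, and there are seven non-zero masks. *)
Lemma separating_mask (l : list (list bool)) : length l = 4 -> (forall v, In v l -> length v = 3) ->
  exists m, forall v w, In v l -> In w l -> xor_word m v <> w.
Proof.
  intros L Hl. destruct l as [|a [|b [|c [|d [|]]]]]; try discriminate. clear L.
  (* The count is confirmed by evaluation over all $8^4$ quadruples of words. *)
  assert (C : forallb (fun a => forallb (fun b => forallb (fun c => forallb (fun d =>
    existsb (fun m => forallb (fun v => forallb (fun w =>
      if list_eq_dec bool_dec (xor_word m v) w then false else true) [a; b; c; d])
      [a; b; c; d]) (words 3)) (words 3)) (words 3)) (words 3)) (words 3) = true)
    by (vm_compute; reflexivity).
  assert (Hw : forall v, In v [a; b; c; d] -> In v (words 3)) by (intros v Hv; now apply in_words, Hl).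
  rewrite forallb_forall in C. specialize (C a (Hw a ltac:(simpl; auto))).
  rewrite forallb_forall in C. specialize (C b (Hw b ltac:(simpl; auto))).
  rewrite forallb_forall in C. specialize (C c (Hw c ltac:(simpl; auto))).
  rewrite forallb_forall in C. specialize (C d (Hw d ltac:(simpl; auto))).
  apply existsb_exists in C as (m & _ & C). exists m. intros v w Hv Hw'.
  rewrite forallb_forall in C. specialize (C v Hv).
  rewrite forallb_forall in C. specialize (C w Hw').
  now destruct (list_eq_dec bool_dec (xor_word m v) w).
Qed.

Section Generators.
Context {n : nat} (n_pos : 0 < n).
Implicit Types (b c d p q z : brick) (x y : Cube n) (f g h : Cube n -> Cube n).

Lemma strip_shape (w : list bool) : length w = 3 ->
  has_shape (n := n) (fun k => if k =? 0 then 3 else 0) (strip w).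
Proof.
  intro L. unfold strip. split; intros k Hk; destruct (Nat.eqb_spec k 0); auto; lia.
Qed.

Lemma strip_disj (s w : list bool) : length s = 3 -> length w = 3 -> s <> w ->
  disj (n := n) (strip s) (strip w).
Proof.
  intros Hs Hw Ne x y E. apply Ne.
  exact (f_equal (fun b => b 0) (has_shape_eq _ _ _ x y (strip_shape s Hs) (strip_shape w Hw) E)).
Qed.

(** At most one letter, which keeps the generators finite in number; longer tails are built by
    conjugation. *)
Definition tails : list brick :=
  whole :: map (fun l => letter (fst l) (snd l)) (list_prod (seq 0 n) [false; true]).

Lemma tails_letter k s : k < n -> In (letter k s) tails.
Proof.
  intro Hk. right. apply in_map_iff. exists (k, s). split; auto. apply in_prod.
  - apply in_seq. lia.
  - destruct s; simpl; auto.
Qed.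

Definition generator_pair b c : Prop := exists s w e,
  length s = 3 /\ length w = 3 /\ s <> w /\ In e tails /\ b = bapp (strip s) e /\ c = strip w.

Lemma sw_sym b c : disj (n := n) b c -> forall x, sw b c x = sw c b x.
Proof.
  intro D. assert (D' := disj_sym _ _ D). apply (sw_elim b c).
  - intro x. now rewrite sw_l, sw_r.
  - intro x. now rewrite sw_r, sw_l.
  - intros x Hb Hc. now rewrite !sw_off.
Qed.

Lemma sw_eqv b b' c : disj (n := n) b c -> (forall x, phi b x = phi b' x) ->
  forall x, sw b' c x = sw b c x.
Proof.
  intros D E. assert (D' : disj (n := n) b' c) by (intros x y; rewrite <- E; apply D).
  apply (sw_elim b c).
  - intro x. rewrite sw_l by auto. now rewrite E, sw_l.
  - intro x. rewrite !sw_r by auto. now rewrite E.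
  - intros x Hb Hc. rewrite !sw_off; auto. intros [y Hy]. apply Hb. exists y. now rewrite E.
Qed.

(** The swap of [b] and [c] moves $cv$ to $bv$ and leaves [d] alone. This is the tool for
    lengthening tails. *)
Lemma sw_conj b c d v x : disj (n := n) b c -> disj (n := n) b d -> disj (n := n) c d ->
  sw (bapp b v) d x = sw b c (sw (bapp c v) d (sw b c x)).
Proof.
  intros Dbc Dbd Dcd. assert (Dcb := disj_sym _ _ Dbc).
  assert (Ddb := disj_sym _ _ Dbd). assert (Ddc := disj_sym _ _ Dcd).
  assert (Db := disj_app_l b v d Dbd). assert (Dc := disj_app_l c v d Dcd).
  revert x. apply (sw_elim (bapp b v) d).
  - intro x. rewrite sw_l, phi_app, sw_l, <- phi_app, sw_l, sw_out; auto.
  - intro x. rewrite sw_r, (sw_out b c d), sw_r, !phi_app, sw_r; auto.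
  - intros x Hb Hd. destruct (classic (covers b x)) as [[y ->]|Nb].
    + rewrite sw_off, sw_l by auto. rewrite (sw_off (bapp c v) d), sw_r; auto.
      * intros [z E]. rewrite phi_app in E. apply phi_inj in E as ->.
        apply Hb. rewrite <- phi_app. apply covers_phi.
      * apply disj_not_covers; auto.
    + destruct (classic (covers c x)) as [[y ->]|Nc].
      * rewrite sw_off, sw_r, (sw_out _ _ b), sw_l; auto.
        apply disj_sym. now apply disj_app_r.
      * rewrite (sw_off b c x), (sw_off (bapp c v) d x), (sw_off b c x), (sw_off (bapp b v) d x);
          auto. intro H. now apply Nc, covers_app with v.
Qed.

Lemma sw_split b c k : k < n -> disj (n := n) b c -> forall x,
  sw b c x = sw (bapp b (letter k false)) (bapp c (letter k false))
                (sw (bapp b (letter k true)) (bapp c (letter k true)) x).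
Proof.
  intros Hk D.
  assert (A : forall s t, disj (n := n) (bapp b (letter k s)) (bapp c (letter k t)))
    by (intros s t; now apply disj_app_l, disj_app_r).
  assert (A' : forall s t, disj (n := n) (bapp c (letter k s)) (bapp b (letter k t)))
    by (intros s t; now apply disj_sym).
  assert (B : forall q s, disj (n := n) (bapp q (letter k s)) (bapp q (letter k (negb s))))
    by (intros q s; now apply disj_app, disj_letter_bool).
  apply (sw_elim b c).
  - intro x. rewrite sw_l by auto. destruct (phi_letter_cover k x Hk) as ([|] & y & ->);
      rewrite <- !phi_app.
    + rewrite sw_l, sw_out; auto; apply (B c false).
    + rewrite (sw_out (bapp b (letter k true))), sw_l; auto; apply (B b true).
  - intro x. rewrite sw_r by auto. destruct (phi_letter_cover k x Hk) as ([|] & y & ->);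
      rewrite <- !phi_app.
    + rewrite sw_r, sw_out; auto; apply (B b false).
    + rewrite (sw_out (bapp b (letter k true))), sw_r; auto; apply (B c true).
  - intros x Hb Hc. rewrite (sw_off b c x) by auto.
    assert (N : forall q s, ~ covers q x -> ~ covers (bapp q (letter k s)) x)
      by (intros q s Nq H; now apply Nq, covers_app with (letter k s)).
    now rewrite (sw_off (bapp b (letter k true))), sw_off by auto.
Qed.

(** To lengthen the tail [v] by one letter, conjugate with the swap of $sv$ and a third strip $u$:
    the new letter then hangs on $u$ itself, where the swap with $w$ is a generator. *)
Lemma generated_to_strip v : (forall k, n <= k -> v k = []) -> forall s w, length s = 3 ->
  length w = 3 -> s <> w -> swap_products generator_pair (sw (n := n) (bapp (strip s) v) (strip w)).
Proof.
  revert v. apply (brick_ind (fun v => forall s w, length s = 3 -> length w = 3 -> s <> w ->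
    swap_products generator_pair (sw (n := n) (bapp (strip s) v) (strip w)))).
  - intros s w Hs Hw Ne. apply swap_products_one; [|now apply disj_app_l, strip_disj].
    exists s, w, whole. repeat split; auto. now left.
  - intros v k t Hk IH s w Hs Hw Ne. destruct (third_word s w) as (u & Hu & Ns & Nw).
    rewrite <- bapp_assoc.
    apply swap_products_ext with (fun x => sw (bapp (strip s) v) (strip u)
      (sw (bapp (strip u) (letter k t)) (strip w) (sw (bapp (strip s) v) (strip u) x))).
    { intro x. symmetry. apply sw_conj; auto using strip_disj, disj_app_l. }
    apply (swap_products_comp _ (sw (bapp (strip s) v) (strip u)) (fun x =>
      sw (bapp (strip u) (letter k t)) (strip w) (sw (bapp (strip s) v) (strip u) x))); auto.
    apply (swap_products_comp _ (sw (bapp (strip u) (letter k t)) (strip w))); auto.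
    apply swap_products_one; [|now apply disj_app_l, strip_disj].
    exists u, w, (letter k t). repeat split; auto using tails_letter.
Qed.

Lemma strip_prefix b : 3 <= length (b 0) -> exists s v, length s = 3 /\
  (forall k, n <= k -> v k = []) /\ forall x, phi b x = phi (bapp (strip s) v) x.
Proof.
  intro L. exists (firstn 3 (b 0)),
    (fun k => if k =? 0 then skipn 3 (b 0) else if k <? n then b k else []). repeat split.
  - apply firstn_length_le. lia.
  - intros k Hk. destruct (Nat.eqb_spec k 0); [lia|]. destruct (Nat.ltb_spec k n); auto; lia.
  - intro x. apply phi_eqv. intros k Hk. unfold bapp, strip.
    destruct (Nat.eqb_spec k 0) as [->|]; [symmetry; apply firstn_skipn|].
    destruct (Nat.ltb_spec k n); auto; lia.
Qed.

(** With a strip [w] avoiding both bricks, conjugating the swap of [c] and [w] by the swap of [b]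
    and [w] gives the swap of [b] and [c], even when these lie in a common strip. *)
Lemma generated_deep b c : 3 <= length (b 0) -> 3 <= length (c 0) -> disj (n := n) b c ->
  swap_products generator_pair (sw (n := n) b c).
Proof.
  intros Lb Lc D. destruct (strip_prefix b Lb) as (s & v & Hs & Hv & Eb).
  destruct (strip_prefix c Lc) as (t & v' & Ht & Hv' & Ec).
  destruct (third_word s t) as (w & Hw & Ns & Nt).
  assert (Db : disj (n := n) b (strip w)).
  { intros x y. rewrite Eb. now apply disj_app_l, strip_disj. }
  assert (Dc : disj (n := n) c (strip w)).
  { intros x y. rewrite Ec. now apply disj_app_l, strip_disj. }
  assert (Gb : swap_products generator_pair (sw (n := n) b (strip w))).
  { eapply swap_products_ext; [apply sw_eqv|apply (generated_to_strip v Hv s w)];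
      auto using disj_app_l, strip_disj. }
  assert (Gc : swap_products generator_pair (sw (n := n) c (strip w))).
  { eapply swap_products_ext; [apply sw_eqv|apply (generated_to_strip v' Hv' t w)];
      auto using disj_app_l, strip_disj. }
  apply swap_products_ext with (fun x => sw b (strip w) (sw c (strip w) (sw b (strip w) x))).
  { assert (H := sw_conj b (strip w) c whole).
    intro x. rewrite <- (bapp_whole b) at 3. rewrite H; auto using disj_sym.
    rewrite bapp_whole. f_equal. apply sw_sym. auto. }
  apply (swap_products_comp _ (sw b (strip w)) (fun x => sw c (strip w) (sw b (strip w) x))); auto.
  now apply swap_products_comp.
Qed.

(** [m] bounds the number of digits that the two bricks lack to depth three in coordinate 0; halving
    both bricks replaces the swap by two deeper ones. *)
Lemma generated_swap m : forall b c, (3 - length (b 0)) + (3 - length (c 0)) <= m ->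
  disj (n := n) b c -> swap_products generator_pair (sw (n := n) b c).
Proof.
  induction m as [|m IH]; intros b c Hm D; [apply generated_deep; auto; lia|].
  destruct (le_lt_dec 3 (length (b 0))) as [Lb|Lb];
    [destruct (le_lt_dec 3 (length (c 0))) as [Lc|Lc]|]; [now apply generated_deep| |];
  (eapply swap_products_ext; [intro x; symmetry; exact (sw_split b c 0 n_pos D x)|];
   apply (swap_products_comp _ (sw _ _) (sw _ _)); apply IH;
   [unfold bapp, letter; rewrite !length_app; cbn [Nat.eqb length]; lia|now apply disj_app_l, disj_app_r
   |unfold bapp, letter; rewrite !length_app; cbn [Nat.eqb length]; lia|now apply disj_app_l, disj_app_r]).
Qed.

Theorem NV_generated f : NV f -> swap_products generator_pair f.
Proof.
  intro Hf. apply NV_is_swap_product in Hf.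
  eapply swap_products_bind; [|exact Hf]. intros b c _ D.
  exact (generated_swap _ b c (le_n _) D).
Qed.

(** * Commuting swaps and translations of the strips *)

Lemma sw_commute b c b' c' : disj (n := n) b c -> disj (n := n) b' c' ->
  disj (n := n) b b' -> disj (n := n) b c' -> disj (n := n) c b' -> disj (n := n) c c' ->
  forall x, sw b c (sw b' c' x) = sw b' c' (sw b c x).
Proof.
  intros D D' D1 D2 D3 D4.
  assert (E1 := disj_sym _ _ D1). assert (E2 := disj_sym _ _ D2).
  assert (E3 := disj_sym _ _ D3). assert (E4 := disj_sym _ _ D4).
  apply (sw_elim b c).
  - intro x. rewrite (sw_out b' c' b), sw_l, (sw_out b' c' c); auto.
  - intro x. rewrite (sw_out b' c' c), sw_r, (sw_out b' c' b); auto.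
  - intros x Hb Hc. rewrite (sw_off b c x) by auto. revert x Hb Hc.
    apply (sw_elim b' c' (fun x => ~ covers b x -> ~ covers c x -> sw b c (sw b' c' x) = sw b' c' x)).
    + intros x _ _. rewrite sw_l by auto. now apply sw_out.
    + intros x _ _. rewrite sw_r by auto. now apply sw_out.
    + intros x Hb' Hc' Hb Hc. now rewrite (sw_off b' c'), sw_off.
Qed.

Lemma carries_map h (F : brick -> brick) l : carries h l (map F l) ->
  forall b, In b l -> forall x, h (phi b x) = phi (F b) x.
Proof.
  induction l as [|c l IH]; intros C b []; inversion C; subst; auto.
Qed.

(** The mask permutes the cells of a grid, and a permutation of a halving pattern is realised by
    swaps. *)
Lemma strip_xor_exists (m : list bool) : exists g, NV g /\
  forall w x, length w = 3 -> g (phi (strip w) x) = phi (strip (xor_word m w)) x.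
Proof.
  set (F := fun (b : brick) k => if k =? 0 then xor_word m (b 0) else b k).
  destruct (halving_cells (n := n) (fun k => if k =? 0 then 3 else 0)) as (l & Hl & Sl).
  assert (P : Permutation (map F l) l).
  { apply NoDup_Permutation_bis.
    - apply NoDup_map_NoDup_ForallPairs; [|now apply (pairwise_disj_NoDup (n := n)), halving_disj].
      intros b c _ _ E. extensionality k. assert (Ek := f_equal (fun d => d k) E).
      unfold F in Ek. destruct (Nat.eqb_spec k 0) as [E0|_]; [|exact Ek].
      rewrite E0. now apply xor_word_inj in Ek.
    - now rewrite length_map.
    - intros c Hc. apply in_map_iff in Hc as (b & <- & Hb). apply Sl in Hb as [Hb Nb].
      apply Sl. unfold F. split; intros k Hk.
      + rewrite <- Hb by auto. destruct (Nat.eqb_spec k 0) as [->|]; auto. apply length_xor_word.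
      + destruct (Nat.eqb_spec k 0); [lia|auto]. }
  destruct (permutation_carried (n := n) l (map F l)) as (g & Sg & Cg & _).
  { now symmetry. }
  { now apply halving_disj. }
  exists g. split; [now apply swap_products_NV in Sg|]. intros w x Hw.
  rewrite (carries_map g F l Cg).
  - apply phi_eqv. intros k _. unfold F, strip. now destruct (k =? 0).
  - apply Sl, strip_shape. exact Hw.
Qed.

End Generators.

(** * Property FA *)

Section FixedPoint.
Context {n : nat} (n_pos : 0 < n) {V : Type} (adj : V -> V -> Prop).
Context (act : (Cube n -> Cube n) -> V -> V).
Context (T : is_tree adj) (A : simplicial_action n adj act) (NI : without_inversions n adj act).

Lemma act_comp g h v : NV g -> NV h -> act (fun x => g (h x)) v = act g (act h v).
Proof. intros Hg Hh. destruct A as (_ & H & _). rewrite H; auto using NV_InNV. Qed.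

Lemma act_automorphism g : NV g -> automorphism adj (act g).
Proof.
  intro Hg. destruct A as (_ & _ & H). destruct (H g (NV_InNV g Hg)) as (_ & I & E).
  split; auto. intros u v. apply E.
Qed.

Lemma act_commute g h v : NV g -> NV h -> (forall x, g (h x) = h (g x)) ->
  act g (act h v) = act h (act g v).
Proof.
  intros Hg Hh E. rewrite <- !act_comp by auto. f_equal. now extensionality x.
Qed.

Lemma act_sw_invol b c v : disj (n := n) b c -> act (sw b c) (act (sw b c) v) = v.
Proof.
  intro D. rewrite <- act_comp by now apply NV_sw.
  replace (fun x => sw b c (sw b c x)) with (fun x : Cube n => x)
    by (extensionality x; symmetry; now apply sw_invol).
  destruct A as (H & _). now rewrite H.
Qed.

Definition fixes g v : Prop := act g v = v.

Lemma act_sw_fixed b c : disj (n := n) b c -> exists v, fixes (sw b c) v.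
Proof.
  intro D. apply (involution_fixed adj T).
  - now apply act_automorphism, NV_sw.
  - intro v. now apply act_sw_invol.
  - intros u v. apply NI. now apply NV_InNV, NV_sw.
Qed.

Lemma fixes_convex g : NV g -> convex adj (fixes g).
Proof. intro Hg. now apply (fixed_convex adj T), act_automorphism. Qed.

Lemma commuting_preserves_fixes g h : NV g -> NV h -> (forall x, g (h x) = h (g x)) ->
  forall v, fixes g v <-> fixes g (act h v).
Proof.
  intros Hg Hh E v. unfold fixes. rewrite act_commute by auto. split; [now intros ->|].
  apply (act_automorphism h Hh).
Qed.

Lemma common_fixed_point g h g' h' k : NV g -> NV h -> NV g' -> NV h' -> NV k ->
  (forall x, g (g' x) = g' (g x)) -> (forall x, g (h' x) = h' (g x)) ->
  (forall x, h (g' x) = g' (h x)) -> (forall x, h (h' x) = h' (h x)) ->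
  (forall x, k (g x) = g' (k x)) -> (forall x, k (h x) = h' (k x)) ->
  (exists v, fixes g v) -> (exists v, fixes h v) -> exists v, fixes g v /\ fixes h v.
Proof.
  intros Hg Hh Hg' Hh' Hk C1 C2 C3 C4 K1 K2 [u Fu] [d Fd].
  destruct (classic (exists v, fixes g v /\ fixes h v)) as [?|N]; auto.
  assert (Dj : forall v, fixes h v -> ~ fixes g v) by (intros v Hv Gv; eauto).
  destruct (gate_exists adj T (fixes g) u d Fu (Dj d Fd)) as [a Ga].
  assert (Fix : forall s, NV s -> (forall x, g (s x) = s (g x)) -> (forall x, h (s x) = s (h x)) ->
    act s a = a).
  { intros s Hs Cg Ch. apply (automorphism_fixes_gate adj T (fixes g) (fixes h) (act s) d);
      auto using fixes_convex, act_automorphism, commuting_preserves_fixes. }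
  assert (Surj : exists v, act k v = a) by (apply A; now apply NV_InNV).
  destruct Surj as [v Ev].
  assert (Back : forall s s', NV s -> NV s' -> (forall x, k (s x) = s' (k x)) -> act s' a = a ->
    fixes s v).
  { intros s s' Hs Hs' E Fa. apply (act_automorphism k Hk). rewrite <- act_comp by auto.
    replace (fun x => k (s x)) with (fun x => s' (k x)) by (extensionality x; auto).
    now rewrite act_comp, Ev. }
  exists v. split; [apply (Back g g')|apply (Back h h')]; auto.
Qed.

Lemma generators_common_fixed_point b c b' c' : generator_pair (n := n) b c ->
  generator_pair (n := n) b' c' -> exists v, fixes (sw b c) v /\ fixes (sw b' c') v.
Proof.
  intros (s & w & e & Hs & Hw & Ne & _ & -> & ->) (s' & w' & e' & Hs' & Hw' & Ne' & _ & -> & ->).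
  (* The mask sends each of the strips, repetitions included, to one different from all four. *)
  destruct (separating_mask [s; w; s'; w']) as [m Hm]; [reflexivity| |].
  { intros v Hv. simpl in Hv. intuition congruence. }
  destruct (strip_xor_exists n_pos m) as (k & Hk & Kk).
  assert (SD := strip_disj n_pos).
  assert (XL : forall v, length v = 3 -> length (xor_word m v) = 3).
  { intros v Hv. now rewrite length_xor_word. }
  assert (XN : forall u v, u <> v -> xor_word m u <> xor_word m v).
  { intros u v N E. now apply N, xor_word_inj with m. }
  assert (XD : forall u v, In u [s; w; s'; w'] -> In v [s; w; s'; w'] ->
    disj (n := n) (strip u) (strip (xor_word m v))).
  { intros u v Hu Hv. assert (length u = 3 /\ length v = 3) as [Lu Lv].
    { simpl in Hu, Hv. intuition congruence. }
    apply SD; auto. intro E. now apply (Hm v u). }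
  assert (Conj : forall u v t, length u = 3 -> length v = 3 -> u <> v -> forall x,
    k (sw (bapp (strip u) t) (strip v) x) =
    sw (bapp (strip (xor_word m u)) t) (strip (xor_word m v)) (k x)).
  { intros u v t Hu Hv N.
    assert (D1 : disj (n := n) (bapp (strip u) t) (strip v)) by auto using disj_app_l.
    assert (D2 : disj (n := n) (bapp (strip (xor_word m u)) t) (strip (xor_word m v)))
      by auto using disj_app_l.
    apply (sw_elim (bapp (strip u) t) (strip v)).
    - intro x. rewrite sw_l by auto. rewrite Kk, phi_app, Kk by auto.
      rewrite <- phi_app, sw_l; auto.
    - intro x. rewrite sw_r by auto. rewrite phi_app, !Kk by auto.
      rewrite sw_r by auto. now rewrite phi_app.
    - intros x Nu Nv. rewrite (sw_off _ _ x) by auto. symmetry.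
      destruct Hk as (_ & Ik & _). apply sw_off; intros [y Ey].
      + apply Nu. exists y. apply Ik. now rewrite Ey, !phi_app, Kk.
      + apply Nv. exists y. apply Ik. now rewrite Ey, Kk. }
  assert (Dis : forall u v t, length u = 3 -> length v = 3 -> u <> v ->
    disj (n := n) (bapp (strip u) t) (strip v)) by auto using disj_app_l.
  apply (common_fixed_point _ _
    (sw (bapp (strip (xor_word m s)) e) (strip (xor_word m w)))
    (sw (bapp (strip (xor_word m s')) e') (strip (xor_word m w'))) k);
    auto using NV_sw, act_sw_fixed.
  all: apply sw_commute; auto; repeat apply disj_app_l; repeat apply disj_app_r;
    apply XD; simpl; auto.
Qed.

Definition generator_list : list (brick * brick) :=
  map (fun t => (bapp (strip (fst (fst t))) (snd t), strip (snd (fst t))))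
    (filter (fun t => if list_eq_dec bool_dec (fst (fst t)) (snd (fst t)) then false else true)
      (list_prod (list_prod (words 3) (words 3)) (tails (n := n)))).

Lemma in_generator_list b c : In (b, c) generator_list <-> generator_pair (n := n) b c.
Proof.
  unfold generator_list. rewrite in_map_iff. split.
  - intros ([[s w] e] & E & H). apply filter_In in H as [H F]. cbn [fst snd] in *.
    apply in_prod_iff in H as [H He]. apply in_prod_iff in H as [Hs Hw].
    apply in_words in Hs, Hw. injection E as <- <-. exists s, w, e.
    destruct (list_eq_dec bool_dec s w); [discriminate|]. auto 7.
  - intros (s & w & e & Hs & Hw & Ne & He & -> & ->). exists (s, w, e). split; auto.
    apply filter_In. cbn [fst snd]. split.
    + apply in_prod; auto. apply in_prod; now apply in_words.
    + now destruct (list_eq_dec bool_dec s w).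
Qed.

Lemma generator_pair_disj b c : generator_pair (n := n) b c -> disj (n := n) b c.
Proof.
  intros (s & w & e & Hs & Hw & Ne & _ & -> & ->). apply disj_app_l. now apply strip_disj.
Qed.

Lemma global_fixed_point : exists v, forall g, InNV n g -> act g v = v.
Proof.
  destruct (helly adj T (map (fun p => fixes (sw (fst p) (snd p))) generator_list)) as [v Hv].
  - intros C HC. apply in_map_iff in HC as ([b c] & <- & H). apply in_generator_list in H.
    now apply fixes_convex, NV_sw, generator_pair_disj.
  - intros C D HC HD. apply in_map_iff in HC as ([b c] & <- & H), HD as ([b' c'] & <- & H').
    apply in_generator_list in H, H'. now apply generators_common_fixed_point.
  - exists v. intros g Hg. apply InNV_NV, (NV_generated n_pos) in Hg.
    induction Hg as [|b c g P D Hg IH].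
    + destruct A as (H & _). now rewrite H.
    + rewrite (act_comp (sw b c) g), IH; [|now apply NV_sw|now apply swap_products_NV in Hg].
      apply (Hv (fixes (sw b c))). apply in_map_iff. exists (b, c). split; auto.
      now apply in_generator_list.
Qed.

End FixedPoint.

(** * Elements of infinite order in the strips *)

Section Drifts.
Context {n : nat} (n_pos : 0 < n).
Implicit Types (b c d p q : brick) (x y : Cube n) (f g h : Cube n -> Cube n).

Definition power h i x : Cube n := Nat.iter i h x.

Lemma power_succ_r h i x : power h (S i) x = power h i (h x).
Proof. apply Nat.iter_succ_r. Qed.

Lemma NV_power h i : NV h -> NV (power h i).
Proof.
  intro Hh. induction i as [|i IH]; [exact NV_id|exact (NV_comp h (power h i) Hh IH)].
Qed.

Lemma power_commute g h i : (forall x, g (h x) = h (g x)) ->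
  forall x, g (power h i x) = power h i (g x).
Proof. intros E x. induction i as [|i IH]; simpl; auto. rewrite E. now f_equal. Qed.

Lemma power_cancel g h i : (forall x, g (h x) = x) -> forall x, power g i (power h i x) = x.
Proof.
  intro E. induction i as [|i IH]; intro x; auto.
  rewrite power_succ_r. simpl. now rewrite E, IH.
Qed.

(** An injection that moves only points of [Z] preserves [Z], and one that fixes [Z] pointwise
    preserves its complement; so at every point one of the two maps acts trivially, before and after
    the other. *)
Lemma supports_commute (Z : Cube n -> Prop) f g : NV f -> NV g ->
  (forall x, ~ Z x -> f x = x) -> (forall x, Z x -> g x = x) -> forall x, f (g x) = g (f x).
Proof.
  intros (_ & If & _) (_ & Ig & _) Hf Hg x. destruct (classic (Z x)) as [Hx|Hx].
  - rewrite Hg by auto. destruct (classic (Z (f x))) as [Hfx|Hfx]; [now rewrite Hg|].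
    assert (E : f x = x) by now apply If, Hf. now rewrite E, Hg.
  - rewrite (Hf x) by auto. destruct (classic (Z (g x))) as [Hgx|Hgx]; [|now apply Hf].
    assert (E : g x = x) by now apply Ig, Hg. now rewrite E, Hf.
Qed.

(* In the halves [p], [q] of the strip: [p0 -> p], [p1 -> q0], [q -> q1], and the inverse map. *)
Lemma drift_exists (s : list bool) : exists h : bool -> Cube n -> Cube n,
  (forall t, NV (h t)) /\ (forall t x, h (negb t) (h t x) = x) /\
  (forall t x, ~ covers (strip s) x -> h t x = x) /\
  (forall t x, h t (phi (bapp (strip s) (letter 0 t)) x) =
               phi (bapp (strip s) (letter 0 t)) (phi (letter 0 t) x)).
Proof.
  set (p := bapp (strip s) (letter 0 false)). set (q := bapp (strip s) (letter 0 true)).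
  set (q0 := bapp q (letter 0 false)). set (q1 := bapp q (letter 0 true)).
  assert (Dpq : disj (n := n) p q) by now apply disj_app, disj_letter.
  assert (Dqp : disj (n := n) q p) by now apply disj_sym.
  assert (Dq0p : disj (n := n) q0 p) by now apply disj_app_l.
  assert (Dpq0 : disj (n := n) p q0) by now apply disj_sym.
  assert (Dq1p : disj (n := n) q1 p) by now apply disj_app_l.
  assert (D01 : disj (n := n) q0 q1) by now apply disj_app, disj_letter.
  assert (Cp : forall x : Cube n, covers p x -> covers (strip s) x)
    by (intro x; apply covers_app).
  assert (Cq : forall x : Cube n, covers q x -> covers (strip s) x)
    by (intro x; apply covers_app).
  assert (Cq0 : forall x : Cube n, covers q0 x -> covers (strip s) x)
    by (intros x H; now apply Cq, covers_app with (letter 0 false)).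
  assert (Cq1 : forall x : Cube n, covers q1 x -> covers (strip s) x)
    by (intros x H; now apply Cq, covers_app with (letter 0 true)).
  set (up := fun x => sw q0 q1 (sw q0 p (sw p q x))).
  set (down := fun x => sw p q (sw q0 p (sw q0 q1 x))).
  (* The index names the half into which the iterates drift: [up] pushes into [q], its inverse
     [down] into [p]. Both directions thus obey one law. *)
  exists (fun t : bool => if t then up else down). split; [|split; [|split]].
  - intros [|].
    + apply (NV_comp (sw q0 q1) (fun x => sw q0 p (sw p q x))); [now apply NV_sw|].
      apply (NV_comp (sw q0 p) (sw p q)); now apply NV_sw.
    + apply (NV_comp (sw p q) (fun x => sw q0 p (sw q0 q1 x))); [now apply NV_sw|].
      apply (NV_comp (sw q0 p) (sw q0 q1)); now apply NV_sw.
  - intros [|] x; unfold up, down; simpl; rewrite !sw_invol; auto; now rewrite sw_invol.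
  - intros t x Hx. assert (~ covers p x /\ ~ covers q x /\ ~ covers q0 x /\ ~ covers q1 x)
      as (Np & Nq & Nq0 & Nq1) by (repeat split; auto).
    destruct t; unfold up, down.
    + now rewrite (sw_off p q x), (sw_off q0 p x), (sw_off q0 q1 x).
    + now rewrite (sw_off q0 q1 x), (sw_off q0 p x), (sw_off p q x).
  - intros [|] x; unfold up, down.
    + fold q. rewrite sw_r, sw_r, sw_l by auto. unfold q1. now rewrite phi_app.
    + fold p. rewrite (sw_out q0 q1 p), sw_r by auto.
      unfold q0. rewrite phi_app, sw_r; auto.
Qed.

Lemma NV_swap_products_ind (Q : (Cube n -> Cube n) -> Prop) :
  Q (fun x => x) ->
  (forall b c g, generator_pair (n := n) b c -> NV g -> Q g -> Q (fun x => sw b c (g x))) ->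
  forall g, NV g -> Q g.
Proof.
  intros Q0 QS g Hg. apply (NV_generated n_pos) in Hg.
  induction Hg as [|b c g P D Hg IH]; auto. apply QS; auto. now apply swap_products_NV in Hg.
Qed.

End Drifts.

(** * Almost invariant sets *)

Section AlmostInvariant.
Context {n : nat} (n_pos : 0 < n).
Implicit Types (b c : brick) (x y : Cube n) (d f g h k w z : Cube n -> Cube n).

Definition mul f g : Cube n -> Cube n := fun x => f (g x).

Lemma mul_assoc f g h : mul (mul f g) h = mul f (mul g h).
Proof. reflexivity. Qed.

Lemma NV_mul f g : NV f -> NV g -> NV (mul f g).
Proof. exact (NV_comp f g). Qed.

Lemma mul_cancel z f g : NV z -> mul z f = mul z g -> f = g.
Proof.
  intros (_ & I & _) E. extensionality x. apply I. exact (f_equal (fun k => k x) E).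
Qed.

Definition drift (s : list bool) : bool -> Cube n -> Cube n :=
  proj1_sig (constructive_indefinite_description _ (drift_exists n_pos s)).

Lemma NV_drift s t : NV (drift s t).
Proof. unfold drift. destruct (constructive_indefinite_description _ _) as (h & H); simpl. apply H. Qed.

Lemma drift_inverse s t x : drift s (negb t) (drift s t x) = x.
Proof. unfold drift. destruct (constructive_indefinite_description _ _) as (h & H); simpl. apply H. Qed.

Lemma drift_off s t x : ~ covers (strip s) x -> drift s t x = x.
Proof. unfold drift. destruct (constructive_indefinite_description _ _) as (h & H); simpl. apply H. Qed.

Lemma drift_phi s t x : drift s t (phi (bapp (strip s) (letter 0 t)) x) =
  phi (bapp (strip s) (letter 0 t)) (phi (letter 0 t) x).
Proof. unfold drift. destruct (constructive_indefinite_description _ _) as (h & H); simpl. apply H. Qed.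

(** Behind the strip come the digits [t] and [negb t]. Every application of the drift inserts one
    more [t], so the run of digits [t] counts the iterates. *)
Definition base_point (s : list bool) (t : bool) : Cube n :=
  phi (bapp (strip s) (letter 0 t)) (phi (letter 0 (negb t)) origin).

Lemma power_drift s t i : power (drift s t) i (base_point s t) =
  phi (bapp (strip s) (letter 0 t)) (power (phi (letter 0 t)) i (phi (letter 0 (negb t)) origin)).
Proof.
  induction i as [|i IH]; [reflexivity|].
  change (drift s t (power (drift s t) i (base_point s t)) =
    phi (bapp (strip s) (letter 0 t))
      (phi (letter 0 t) (power (phi (letter 0 t)) i (phi (letter 0 (negb t)) origin)))).
  rewrite IH. apply drift_phi.
Qed.

Lemma power_drift_inj s t i j :
  power (drift s t) i (base_point s t) = power (drift s t) j (base_point s t) -> i = j.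
Proof.
  rewrite !power_drift. intro E. apply phi_inj in E. revert j E.
  induction i as [|i IH]; intros [|j] E; auto.
  - destruct (disj_letter_bool 0 t n_pos _ _ (eq_sym E)).
  - destruct (disj_letter_bool 0 t n_pos _ _ E).
  - f_equal. apply IH. exact (phi_inj _ _ _ E).
Qed.

Lemma drift_commute s s' t t' : length s = 3 -> length s' = 3 -> s <> s' ->
  forall x, drift s t (drift s' t' x) = drift s' t' (drift s t x).
Proof.
  intros Hs Hs' Ne. apply (supports_commute (covers (strip s))); auto using NV_drift, drift_off.
  intros x Hx. apply drift_off. intro Hx'. exact (disj_covers _ _ x (strip_disj n_pos s s' Hs Hs' Ne) Hx Hx').
Qed.

Lemma drift_commute_swap s t b c : disj (n := n) b c -> disj (n := n) b (strip s) ->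
  disj (n := n) c (strip s) -> forall x, drift s t (sw b c x) = sw b c (drift s t x).
Proof.
  intros D Db Dc. apply (supports_commute (covers (strip s))); auto using NV_drift, drift_off, NV_sw.
  intros x [y ->]. now apply sw_out.
Qed.

Lemma power_drift_off s t i x : ~ covers (strip s) x -> power (drift s t) i x = x.
Proof.
  intro Hx. induction i as [|i IH]; auto.
  rewrite power_succ_r. now rewrite drift_off.
Qed.

Lemma power_drift_covers s t i : covers (strip s) (power (drift s t) i (base_point s t)).
Proof. rewrite power_drift, phi_app. apply covers_phi. Qed.

(** The base point in the strip [s] is not moved by the drift in [s']; evaluation there removes the
    second factor. *)
Lemma powers_drift_inj s s' t t' i j i' j' : length s = 3 -> length s' = 3 -> s <> s' ->
  mul (power (drift s t) i) (power (drift s' t') j) =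
  mul (power (drift s t) i') (power (drift s' t') j') -> i = i'.
Proof.
  intros Hs Hs' Ne E. apply power_drift_inj with s t.
  assert (N : ~ covers (strip s') (base_point s t)).
  { intro H. refine (disj_covers _ _ _ (strip_disj n_pos s s' Hs Hs' Ne) _ H).
    exact (power_drift_covers s t 0). }
  assert (Ex : mul (power (drift s t) i) (power (drift s' t') j) (base_point s t) =
               mul (power (drift s t) i') (power (drift s' t') j') (base_point s t)) by now rewrite E.
  unfold mul in Ex. now rewrite !(power_drift_off s') in Ex by auto.
Qed.

(** Translation is on the right, matching the edges from [w] to $ws$ of the Cayley graph. *)
Definition almost_invariant (A : (Cube n -> Cube n) -> Prop) : Prop :=
  forall g, NV g -> exists L, forall w, NV w -> ~ (A w <-> A (mul w g)) -> In w L.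

(** Each entry of [L] can be the value for one [i] only, so the bound holds for all [j]
    simultaneously. *)
Lemma eventually_not_in (F : nat -> nat -> Cube n -> Cube n) L :
  (forall i j i' j', F i j = F i' j' -> i = i') ->
  exists N, forall i j, N <= i -> ~ In (F i j) L.
Proof.
  intro I. induction L as [|a L [N HN]]; [exists 0; intros i j _ []|].
  destruct (classic (exists i j, F i j = a)) as [(i0 & j0 & E)|No].
  - exists (N + S i0). intros i j Hi [H|H].
    + rewrite <- E in H. apply I in H. lia.
    + apply (HN i j); auto. lia.
  - exists N. intros i j Hi [H|H]; [eauto|]. now apply (HN i j).
Qed.

Section Dichotomy.
Context (A : (Cube n -> Cube n) -> Prop) (AI : almost_invariant A).

Definition tends z h (e : Prop) : Prop :=
  exists N, forall i, N <= i -> (A (mul z (power h i)) <-> e).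

Lemma tends_unique z h e e' : tends z h e -> tends z h e' -> (e <-> e').
Proof.
  intros [N HN] [N' HN']. specialize (HN (N + N')). specialize (HN' (N + N')).
  rewrite <- HN, <- HN' by lia. tauto.
Qed.

Lemma tends_iff z h e e' : (e <-> e') -> tends z h e -> tends z h e'.
Proof. intros E [N HN]. exists N. intros i Hi. rewrite HN; auto. Qed.

(** As $zkh^i=zh^ik$ and the $zh^i$ are distinct, almost invariance under [k] lets the two sequences
    differ in membership for finitely many [i] only. *)
Lemma tends_translate z k s t e : NV z -> NV k ->
  (forall x, k (drift s t x) = drift s t (k x)) ->
  tends (mul z k) (drift s t) e <-> tends z (drift s t) e.
Proof.
  intros Hz Hk C. destruct (AI k Hk) as [L HL].
  destruct (eventually_not_in (fun i _ => mul z (power (drift s t) i)) L) as [M HM].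
  { intros i j i' j' E. apply mul_cancel in E; auto. apply power_drift_inj with s t. now rewrite E. }
  assert (Q : forall i, M <= i ->
    (A (mul z (power (drift s t) i)) <-> A (mul (mul z k) (power (drift s t) i)))).
  { intros i Hi. apply NNPP. intro H. apply (HM i 0 Hi). apply HL.
    - auto using NV_mul, NV_power, NV_drift.
    - intro E. apply H. rewrite E. replace (mul (mul z (power (drift s t) i)) k) with
        (mul (mul z k) (power (drift s t) i)); [tauto|].
      extensionality x. unfold mul. now rewrite (power_commute k). }
  split; intros [N HN]; exists (N + M); intros i Hi.
  - rewrite Q by lia. apply HN. lia.
  - rewrite <- Q by lia. apply HN. lia.
Qed.

(** In the array $zh^ih'^j$ a row with large $i$ never changes membership, so its limit in $j$ is
    its value at $j=0$. Commutation identifies this limit with that of $zh'^j$, which is independent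
    of $i$. Existence and equality of both limits come out together. *)
Lemma tends_common z s s' t t' : NV z -> length s = 3 -> length s' = 3 -> s <> s' ->
  exists e, tends z (drift s t) e /\ tends z (drift s' t') e.
Proof.
  intros Hz Hs Hs' Ne. destruct (AI (drift s' t') (NV_drift s' t')) as [L HL].
  set (F := fun i j => mul z (mul (power (drift s t) i) (power (drift s' t') j))).
  destruct (eventually_not_in F L) as [N HN].
  { intros i j i' j' E. apply mul_cancel in E; auto. now apply powers_drift_inj in E. }
  assert (Row : forall i j, N <= i -> (A (F i j) <-> A (mul z (power (drift s t) i)))).
  { intros i j Hi. induction j as [|j IH]; [reflexivity|]. rewrite <- IH. apply NNPP. intro H.
    apply (HN i j Hi). apply HL.
    - unfold F. auto using NV_mul, NV_power, NV_drift.
    - intro E. apply H. rewrite E. replace (mul (F i j) (drift s' t')) with (F i (S j)); [tauto|].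
      extensionality x. unfold F, mul. now rewrite power_succ_r. }
  assert (Lim : forall i, N <= i -> tends z (drift s' t') (A (mul z (power (drift s t) i)))).
  { intros i Hi. apply (tends_translate z (power (drift s t) i)); auto using NV_power, NV_drift.
    - intro x. symmetry. apply power_commute. intro y. symmetry. now apply drift_commute.
    - exists 0. intros j _. exact (Row i j Hi). }
  exists (A (mul z (power (drift s t) N))). split; [|now apply Lim].
  exists N. intros i Hi. apply tends_unique with z (drift s' t'); auto.
Qed.

Definition limit z e : Prop := forall s t, length s = 3 -> tends z (drift s t) e.

(** Only different strips can be compared, hence the two reference strips: any given one differs
    from at least one of them. *)
Lemma limit_exists z : NV z -> exists e, limit z e.
Proof.
  intro Hz. set (s0 := [true; true; true]). set (s1 := [false; true; true]).
  assert (N01 : s0 <> s1) by discriminate.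
  destruct (tends_common z s0 s1 true true Hz eq_refl eq_refl N01) as (e & H0 & H1).
  exists e. intros s t Hs. destruct (classic (s = s0)) as [->|Ns].
  - destruct (tends_common z s0 s1 t true) as (e' & H & H'); auto.
    apply tends_iff with e'; auto. apply tends_unique with z (drift s1 true); auto.
  - destruct (tends_common z s s0 t true) as (e' & H & H'); auto.
    apply tends_iff with e'; auto. apply tends_unique with z (drift s0 true); auto.
Qed.

(** The generator touches two strips, and the drift in a third commutes with it. Agreement of the
    limits there is enough, as all strips share one limit. *)
Lemma limit_swap z b c e : NV z -> generator_pair (n := n) b c -> limit z e -> limit (mul z (sw b c)) e.
Proof.
  intros Hz P He. assert (D := generator_pair_disj n_pos b c P).
  destruct P as (s & w & e' & Hs & Hw & Ne & _ & Eb & Ec).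
  destruct (limit_exists (mul z (sw b c))) as [e1 He1]; [auto using NV_mul, NV_sw|].
  destruct (third_word s w) as (r & Hr & Nrs & Nrw).
  assert (E : e1 <-> e).
  { apply tends_unique with z (drift r true); [|now apply He].
    apply (tends_translate z (sw b c)); auto using NV_sw.
    intro x. symmetry. apply drift_commute_swap; auto; subst b c.
    - apply disj_app_l. now apply strip_disj; auto.
    - now apply strip_disj; auto. }
  intros s' t' Hs'. apply tends_iff with e1; auto.
Qed.

Lemma limit_constant e : limit (fun x => x) e -> forall w, NV w -> limit w e.
Proof.
  intros He w Hw.
  (* Generators are peeled off at the left of [w] and must be absorbed into [z] from the right, so
     [z] has to vary. *)
  enough (H : forall z, NV z -> limit z e -> limit (mul z w) e) by exact (H _ NV_id He).
  revert w Hw. apply (NV_swap_products_ind n_pos (fun w => forall z, NV z -> limit z e -> limit (mul z w) e)).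
  - auto.
  - intros b c g P Hg IH z Hz Lz. apply (IH (mul z (sw b c))).
    + apply NV_mul; auto. now apply NV_sw, generator_pair_disj.
    + now apply limit_swap.
Qed.

(** From [w] in [A], the powers of $h$ lead out of [A] at some $d=wh^j$ in the finite list [L].
    Drifting back from [d] by $h^{-1}$ also ends outside [A], after at most [M] steps for all [d] in
    [L]. Hence $j<M$, and $w=dh^{-j}$ is one of finitely many elements. *)
Lemma finite_of_limit_false : (forall w, NV w -> limit w False) ->
  exists L, forall w, NV w -> A w -> In w L.
Proof.
  intro HF. set (s := [true; true; true]). set (h := drift s true). set (h' := drift s false).
  destruct (AI h (NV_drift s true)) as [L HL].
  assert (HM : exists M, forall d, In d L -> NV d -> forall i, M <= i -> ~ A (mul d (power h' i))).
  { clear HL. induction L as [|a L [M HM]]; [exists 0; intros d []|].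
    destruct (classic (NV a)) as [Ha|Na].
    - destruct (HF a Ha s false eq_refl) as [N HN]. exists (M + N). intros d [<-|Hd] Nd i Hi.
      + intro H. apply (HN i); [lia|exact H].
      + apply HM; auto. lia.
    - exists M. intros d [<-|Hd]; [contradiction|auto]. }
  destruct HM as [M HM].
  exists (flat_map (fun d => map (fun i => mul d (power h' i)) (seq 0 M)) L).
  intros w Hw Aw.
  assert (Ex : exists j, A (mul w (power h j)) /\ ~ A (mul w (power h (S j)))).
  { apply NNPP. intro No. destruct (HF w Hw s true eq_refl) as [N HN].
    apply (HN N); auto. clear HN. induction N as [|N IH]; auto.
    apply NNPP. intro H. apply No. eauto. }
  destruct Ex as (j & Aj & NAj).
  assert (Back : mul (mul w (power h j)) (power h' j) = w).
  { extensionality x. unfold mul. rewrite (power_cancel h h'); auto.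
    intro y. exact (drift_inverse s false y). }
  assert (NVj : NV (mul w (power h j))) by (apply NV_mul; auto; now apply NV_power, NV_drift).
  apply in_flat_map. exists (mul w (power h j)). split.
  - apply HL; auto. intro E. apply NAj. replace (mul w (power h (S j))) with (mul (mul w (power h j)) h).
    + now apply E.
    + extensionality x. unfold mul. now rewrite power_succ_r.
  - apply in_map_iff. exists j. split; auto. apply in_seq. split; [lia|].
    destruct (le_lt_dec M j) as [Hj|]; auto. exfalso.
    apply (HM (mul w (power h j))) with j; auto.
    + apply HL; auto. intro E. apply NAj. replace (mul w (power h (S j))) with (mul (mul w (power h j)) h).
      * now apply E.
      * extensionality x. unfold mul. now rewrite power_succ_r.
    + now rewrite Back.
Qed.

End Dichotomy.

Theorem almost_invariant_finite_or_cofinite A : almost_invariant A ->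
  (exists L, forall w, NV w -> A w -> In w L) \/ (exists L, forall w, NV w -> ~ A w -> In w L).
Proof.
  intro AI. destruct (limit_exists A AI (fun x => x) NV_id) as [e He].
  assert (Lim := limit_constant A AI e He).
  destruct (classic e) as [Ye|Ne].
  - right. apply (finite_of_limit_false (fun w => ~ A w)).
    + intros g Hg. destruct (AI g Hg) as [L HL]. exists L. intros w Hw H. apply HL; auto. tauto.
    + intros w Hw s t Hs. destruct (Lim w Hw s t Hs) as [N HN]. exists N. intros i Hi.
      specialize (HN i Hi). tauto.
  - left. apply (finite_of_limit_false A AI). intros w Hw s t Hs.
    apply tends_iff with e; [tauto|]. now apply Lim.
Qed.

End AlmostInvariant.

(** * Ends of Cayley graphs *)

Section Cayley.
Context {n : nat} (n_pos : 0 < n) (S : list (Cube n -> Cube n)) (HS : generating_set n S).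
Implicit Types (x y z g h w : Cube n -> Cube n) (K p : list (Cube n -> Cube n)).

Lemma is_walk_snoc {V} (adj : V -> V -> Prop) u (p : list V) v :
  is_walk adj (u :: p ++ [v]) <-> is_walk adj (u :: p) /\ adj (last p u) v.
Proof.
  revert u. induction p as [|a p IH]; intro u; [simpl; tauto|].
  rewrite last_shift. simpl in *. rewrite IH. tauto.
Qed.

Lemma NV_generator s : In s S -> NV s.
Proof. intro H. now apply InNV_NV, HS. Qed.

Lemma NV_generated_by g : generated n S g -> NV g.
Proof.
  induction 1 as [|g s _ IH H|g s h _ IH H Hh _ _]; [exact NV_id| |].
  - apply (NV_comp g s); auto using NV_generator.
  - apply (NV_comp g h); auto using InNV_NV.
Qed.

Lemma cay_adj_sym x y : cay_adj n S x y -> cay_adj n S y x.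
Proof. intros (Hx & Hy & s & H & E). repeat split; auto. exists s. tauto. Qed.

Lemma cay_adj_mul g s : NV g -> In s S -> cay_adj n S g (mul g s).
Proof.
  intros Hg H. split; [now apply NV_InNV|split; [|exists s; auto]].
  apply NV_InNV, NV_mul; auto using NV_generator.
Qed.

Lemma conn_step K x y z : conn_avoid n S K x y -> cay_adj n S y z -> ~ In z K ->
  conn_avoid n S K x z.
Proof.
  intros (p & W & <- & F) A Nz. exists (p ++ [z]). repeat split.
  - now apply is_walk_snoc.
  - apply last_last.
  - rewrite app_comm_cons. apply Forall_app. auto.
Qed.

Lemma conn_NV K x y : NV x -> conn_avoid n S K x y -> NV y.
Proof.
  intros Hx (p & W & <- & _). destruct p as [|a p _] using rev_ind; auto.
  rewrite last_last. apply is_walk_snoc in W as (_ & _ & H & _). now apply InNV_NV.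
Qed.

Lemma conn_back K x y z : conn_avoid n S K y z -> conn_avoid n S K x z -> conn_avoid n S K x y.
Proof.
  intros (p & W & <- & F) Cz. revert y W F Cz. induction p as [|a p IH]; intros y W F Cz; auto.
  rewrite last_shift in Cz. destruct W as [A W]. inversion F; subst.
  apply conn_step with a; auto. now apply cay_adj_sym.
Qed.

Lemma almost_invariant_mul (A : (Cube n -> Cube n) -> Prop) g h : NV g ->
  (exists L, forall w, NV w -> ~ (A w <-> A (mul w g)) -> In w L) ->
  (exists L, forall w, NV w -> ~ (A w <-> A (mul w h)) -> In w L) ->
  exists L, forall w, NV w -> ~ (A w <-> A (mul w (mul g h))) -> In w L.
Proof.
  intros Hg [L HL] [M HM]. destruct (NV_inv g Hg) as (g' & _ & _ & E).
  exists (L ++ map (fun w => mul w g') M). intros w Hw H. apply in_or_app.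
  destruct (classic (A w <-> A (mul w g))) as [H1|H1]; [right|left; auto].
  apply in_map_iff. exists (mul w g). split.
  - extensionality x. unfold mul. now rewrite E.
  - apply HM; auto using NV_mul. rewrite mul_assoc. tauto.
Qed.

(** An edge with both ends off [K] stays in one component, so for a generator $s$ membership can
    change only at [K] or $Ks^{-1}$. Inverses use the same edges backwards, and products add up
    finite sets. *)
Lemma component_almost_invariant K x : NV x -> almost_invariant (conn_avoid n S K x).
Proof.
  intro Hx. set (A := conn_avoid n S K x).
  assert (Gen : forall s, In s S -> exists L, forall w, NV w -> ~ (A w <-> A (mul w s)) -> In w L).
  { intros s Hs. destruct (NV_inv s (NV_generator s Hs)) as (s' & _ & _ & E).
    exists (K ++ map (fun w => mul w s') K). intros w Hw H. apply in_or_app.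
    destruct (classic (In w K)) as [?|Nw]; auto. right. apply in_map_iff. exists (mul w s). split.
    - extensionality y. unfold mul. now rewrite E.
    - apply NNPP. intro Nws. apply H. assert (Adj := cay_adj_mul w s Hw Hs).
      split; intro C.
      + now apply conn_step with w.
      + apply conn_step with (mul w s); auto. now apply cay_adj_sym. }
  intros g Hg. apply NV_InNV, HS in Hg.
  induction Hg as [|g s Hg IH Hs|g s h Hg IH Hs Hh E1 E2].
  - exists []. intros w _ H. apply H. reflexivity.
  - apply almost_invariant_mul; auto. now apply NV_generated_by.
  - apply almost_invariant_mul; auto; [now apply NV_generated_by|].
    destruct (Gen s Hs) as [L HL]. exists (map (fun w => mul w s) L). intros w Hw H.
    apply in_map_iff. exists (mul w h).
    assert (E : mul (mul w h) s = w).
    { rewrite mul_assoc. unfold mul at 2. now rewrite E2. }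
    split; auto. apply HL; [apply NV_mul; auto using InNV_NV|]. rewrite E. tauto.
Qed.

(** * Balls and unbounded components *)

Lemma within_step N g h : within n S N g -> cay_adj n S g h -> within n S (N + 1) h.
Proof.
  intros (p & W & <- & L) A. exists (p ++ [h]). repeat split.
  - now apply is_walk_snoc.
  - apply last_last.
  - rewrite length_app. simpl. lia.
Qed.

Lemma within_mono N M g : N <= M -> within n S N g -> within n S M g.
Proof. intros L (p & W & E & H). exists p. repeat split; auto. lia. Qed.

Lemma within_some g : NV g -> exists N, within n S N g.
Proof.
  intro Hg. apply NV_InNV, HS in Hg.
  induction Hg as [|g s Hg [N IH] Hs|g s h Hg [N IH] Hs Hh E1 E2].
  - exists 0, []. repeat split; auto.
  - exists (N + 1). apply within_step with g; auto.
    apply cay_adj_mul; auto. now apply NV_generated_by.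
  - exists (N + 1). apply within_step with g; auto. apply cay_adj_sym.
    assert (E : mul (mul g h) s = g) by (rewrite mul_assoc; unfold mul at 2; now rewrite E2).
    assert (H : cay_adj n S (mul g h) (mul (mul g h) s)).
    { apply cay_adj_mul; auto. apply NV_mul; [now apply NV_generated_by|now apply InNV_NV]. }
    rewrite E in H. exact H.
Qed.

Lemma finite_within L : exists N, forall g, In g L -> NV g -> within n S N g.
Proof.
  induction L as [|a L [N HN]]; [exists 0; intros g []|].
  destruct (classic (NV a)) as [Ha|Na].
  - destruct (within_some a Ha) as [M HM]. exists (N + M). intros g [<-|Hg] Ng.
    + apply within_mono with M; auto. lia.
    + apply within_mono with N; auto. lia.
  - exists N. intros g [<-|Hg] Ng; [contradiction|auto].
Qed.

(** The group elements in a finite list lie in one ball, which an unbounded component must leave. *)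
Lemma unbounded_infinite K x L : in_unbounded_comp n S K x ->
  ~ forall y, NV y -> conn_avoid n S K x y -> In y L.
Proof.
  intros (Hx & _ & U) H. destruct (finite_within L) as [N HN].
  destruct (U N) as (y & C & NW). apply NW.
  assert (NV y) by (apply (conn_NV K x y); auto using InNV_NV). auto.
Qed.

Lemma ball_finite N : exists L, forall g, within n S N g -> In g L.
Proof.
  (* An edge may also be traversed against its generator; a chosen right inverse recovers the end of
     such an edge. *)
  assert (Inv : forall s, exists s', In s S -> forall c : Cube n, s (s' c) = c).
  { intro s. destruct (classic (In s S)) as [H|H]; [|exists s; contradiction].
    destruct (NV_inv s (NV_generator s H)) as (s' & _ & _ & E). eauto. }
  apply choice in Inv as [inv Hinv].
  induction N as [|N [L HL]].
  - exists [idf n]. intros g (p & _ & E & Lp). destruct p; [left; auto|simpl in Lp; lia].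
  - exists (L ++ flat_map (fun s => map (fun g => mul g s) L ++ map (fun g => mul g (inv s)) L) S).
    intros g (p & W & E & Lp). apply in_or_app.
    destruct p as [|z p _] using rev_ind.
    + left. apply HL. exists []. repeat split; auto. simpl. lia.
    + right. rewrite last_last in E. subst z. apply is_walk_snoc in W as (W & _ & _ & s & Hs & E).
      rewrite length_app in Lp. simpl in Lp.
      assert (Hl : In (last p (idf n)) L) by (apply HL; exists p; repeat split; auto; lia).
      apply in_flat_map. exists s. split; auto. apply in_or_app. destruct E as [E|E]; [left|right];
        apply in_map_iff; exists (last p (idf n)); split; auto.
      rewrite E. extensionality x. unfold mul. now rewrite Hinv.
Qed.

Lemma conn_nil g : NV g -> conn_avoid n S [] (idf n) g.
Proof.
  intro Hg. destruct (within_some g Hg) as (N & p & W & E & _). exists p. repeat split; auto.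
  apply Forall_forall. auto.
Qed.

Lemma NV_infinite L : ~ forall g, NV g -> In g L.
Proof.
  intro H. set (s := [true; true; true]).
  assert (I : forall i, In (power (drift n_pos s true) i) L) by (intro i; apply H, NV_power, NV_drift).
  assert (ND : NoDup (map (power (drift n_pos s true)) (seq 0 (length L + 1)))).
  { apply NoDup_map_NoDup_ForallPairs; [|apply seq_NoDup].
    intros i j _ _ E. apply (power_drift_inj n_pos s true). now rewrite E. }
  apply NoDup_incl_length with (l' := L) in ND.
  - rewrite length_map, length_seq in ND. lia.
  - intros g Hg. apply in_map_iff in Hg as (i & <- & _). apply I.
Qed.

Theorem one_end : ends_eq_one n S.
Proof.
  split.
  - intros K x y Ux Uy. apply NNPP. intro N.
    assert (Hx : NV x) by (apply InNV_NV, Ux).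
    destruct (almost_invariant_finite_or_cofinite n_pos _ (component_almost_invariant K x Hx))
      as [[L HL]|[L HL]].
    + now apply (unbounded_infinite K x L Ux).
    (* A cofinite component of [x] leaves only finitely many elements for the component of [y]. *)
    + apply (unbounded_infinite K y L Uy). intros z Hz C. apply HL; auto. intro C'.
      apply N. now apply conn_back with z.
  (* With nothing removed, the component of the identity is the whole graph, which is infinite while
     balls are finite. *)
  - exists [], (idf n). split; [apply NV_InNV, NV_id|split; auto].
    intro N. apply NNPP. intro H. destruct (ball_finite N) as [L HL].
    apply (NV_infinite L). intros g Hg. apply HL. apply NNPP. intro Ng. apply H.
    exists g. split; auto. now apply conn_nil.
Qed.

End Cayley.

Theorem theorem4p6 : forall n : nat, (1 <= n)%nat ->
  nV_has_FA n /\
  (forall S : list (Cube n -> Cube n), generating_set n S -> ends_eq_one n S).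
Proof.
  intros n Hn. split.
  - intros V adj act T A NI. now apply (global_fixed_point Hn adj act).
  - intros S HS. now apply one_end.
Qed.
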